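(* Let $n\ge3$, $b>0$, and let $0<s<\frac12$ be irrational. There are functions $L^{\pm}_{s,b}\in\mathcal{C}^\infty([0,\infty))$ such that, as $|x_n|+|x'|$ tends to zero with $|x'|/|x_n|$ bounded above, $$\frac{1}{|x'|^{\frac{n-3}{2}}}\int_0^\infty J_{\frac{n-3}{2}}(r|x'|)\,r^{\frac{n-1}{2}}e^{-r|x_n|}I^\pm_s(r,x_n)\,dr=\frac{L^\pm_{s,b}\left(\frac{|x'|}{|x_n|}\right)}{(x_n^2+|x'|^2)^{\frac{n-2+2s}{2}}}+O\left(\frac{1}{(|x_n|+|x'|)^{n-3+4s}}\right).$$
   Context: Here $(x',x_n)\in\mathbb{R}^{n-1}\times\mathbb{R}$, $J_\mu$ is the Bessel function of the first kind of order $\mu$, and for $r>0$ $$I^\pm_s(r,x_n)=4\pi\int_0^\infty\frac{\sin(\pi s)\,e^{-|x_n|\sigma}\,\sigma^s(\sigma+2r)^s}{|\sigma^s(\sigma+2r)^se^{\pi is}\mp b(\sigma+r)|^2}\,d\sigma$$ (the upper sign corresponds to $x_n>0$, the lower to $x_n<0$). At $x'=0$ the left side is understood by continuity. *)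

(* Defs.v *)
From HB Require Import structures.
From mathcomp Require Import all_boot all_order all_algebra.
From mathcomp Require Import complex.
From mathcomp Require Import all_classical all_reals all_analysis.

Set Implicit Arguments.
Unset Strict Implicit.
Unset Printing Implicit Defensive.

Import Order.TTheory GRing.Theory Num.Theory.
Import numFieldNormedType.Exports.

Local Open Scope classical_set_scope.
Local Open Scope ring_scope.

(* Euclidean norm; the norm that the library puts on row vectors is the
   sup norm, which induces the same topology. *)
Definition enorm (R : realType) (m : nat) (x : 'rV[R]_m) : R :=
  Num.sqrt (\sum_(i < m) x ord0 i ^+ 2).

(* Only meant for 0 < x. *)
Definition Gamma (R : realType) (x : R) : R :=
  \int[lebesgue_measure]_(t in `]0, +oo[) (t `^ (x - 1) * expR (- t)).

(* Bessel function of the first kind, by its power series; only meant for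
   -1 < mu and 0 < z, so that Gamma is evaluated at positive arguments. *)
Definition besselJ (R : realType) (mu z : R) : R :=
  limn (series (fun k : nat =>
    (-1) ^+ k / (k`!%:R * Gamma (k%:R + mu + 1))
      * (z / 2) `^ (k%:R * 2 + mu))).

(* f is C^oo on the closed half-line, in the sense that all its derivatives
   relative to [0, +oo[ exist (one-sided at 0): D k is the k-th one. *)
Definition smooth_halfline (R : realType) (f : R -> R) : Prop :=
  exists D : nat -> R -> R,
    (forall x, 0 <= x -> D 0%N x = f x) /\
    (forall k x, 0 <= x ->
      (D k y - D k x) / (y - x) @[y --> within `[0, +oo[ x^'] --> D k.+1 x).

(* In what follows e : bool encodes the choice of sign: e = false is the upper
   sign (superscript +, x_n > 0) and e = true is the lower sign (superscript -,
   x_n < 0); hence -/+ b is - (-1) ^+ e * b. *)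

(* sigma^s (sigma + 2 r)^s e^(pi i s) -/+ b (sigma + r) *)
Definition Idenom (R : realType) (b s : R) (e : bool) (r sigma : R) : R[i] :=
  ((sigma `^ s * (sigma + 2 * r) `^ s)%:C * (cos (pi * s) +i* sin (pi * s))
     - ((-1) ^+ e * b * (sigma + r))%:C)%C.

Definition Iint (R : realType) (b s : R) (e : bool) (r xn : R) : R :=
  4 * pi * \int[lebesgue_measure]_(sigma in `]0, +oo[)
    (sin (pi * s) * expR (- `|xn| * sigma)
       * (sigma `^ s * (sigma + 2 * r) `^ s)
     / Normc.normc (Idenom b s e r sigma) ^+ 2).

Definition lhs_off (R : realType) (n : nat) (b s : R) (e : bool)
    (x' : 'rV[R]_n.-1) (xn : R) : R :=
  1 / enorm x' `^ ((n%:R - 3) / 2)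
    * \int[lebesgue_measure]_(r in `]0, +oo[)
        (besselJ ((n%:R - 3) / 2) (r * enorm x') * r `^ ((n%:R - 1) / 2)
           * expR (- (r * `|xn|)) * Iint b s e r xn).

Definition lhs (R : realType) (n : nat) (b s : R) (e : bool)
    (x' : 'rV[R]_n.-1) (xn : R) : R :=
  if x' == 0 then lim (lhs_off b s e y xn @[y --> (0 : 'rV[R]_n.-1)^'])
  else lhs_off b s e x' xn.

(* Main.v *)
Require Import Defs.
From HB Require Import structures.
From mathcomp Require Import all_boot all_order all_algebra.
From mathcomp Require Import complex ring lra.
From mathcomp Require Import all_classical all_reals all_analysis.
From mathcomp Require Import measurable_realfun.

(** Write a = |x_n|, rho = |x'|, nu = (n-3)/2, and let
    A = sigma^s (sigma + 2r)^s and B = b (sigma + r) be the two terms of the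
    denominator of I_s. Small (x', x_n) makes large r and sigma matter, and
    there A = O((sigma + r)^(2s)) is dominated by B because 2s < 1. The idea is
    to replace 1/|A e^(i pi s) -/+ B|^2 by 1/B^2.

    - Main term. The kernel A/B^2 ([kern_main]) is homogeneous of degree 2s-2,
      so the double integral in which it replaces A/|A e^(i pi s) -/+ B|^2 is
      exactly a^-(n-2+2s) times a function of rho/a ([hankel_main_homo]).
      Multiplying that function by (1 + (rho/a)^2)^((n-2+2s)/2) turns the power
      of a into a power of x_n^2 + rho^2; this is L, and it is the same for both
      signs, since the sign does not survive in B^2.

    - Error. As s < 1/2, sin(pi s) > 0, and
      |A e^(i pi s) -/+ B|^2 >= sin(pi s)^2 max(A, B)^2, whence
      |A/|A e^(i pi s) -/+ B|^2 - A/B^2| <= 3 A^2 / (sin(pi s)^2 B^3)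
      for all r, sigma > 0 and not only for large ones ([kern_diff_le]). The
      right-hand side is at most a constant times r^(2s-2) sigma^(2s-1), so the
      error is controlled by two Gamma integrals, which scale like
      a^-(2s) and a^-(n-3+2s) ([hankel_diff_le]).

    - Bessel function. J_nu(z) = (z/2)^nu g_nu((z/2)^2) with g_nu entire and
      g_nu' = - g_(nu+1). Both parts above need a bound for g_nu on [0, +oo[ without
      exponential growth (rho/a may be any bounded number, while the only decay
      at hand is e^-(ra)). By the three-term recurrence, which is
      Bessel's differential equation, the energy
      g_nu(u)^2 + u g_(nu+1)(u)^2 has derivative
      -(2 nu + 1) g_(nu+1)(u)^2 <= 0 ([clifford_energy]), hence
      |g_nu| <= g_nu(0) on [0, +oo[. The recurrence in turn rests on
      Gamma(p+1) = p Gamma(p), proved by parts on [1/N, N] ([gammaE_succ]).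

    - Smoothness of L. Differentiation under the integral sign replaces
      (nu, r^p) by (nu + 1, r^(p+2)) ([is_derive_hankel]), so all the functions
      obtained from L by differentiation lie in the span of
      z^m (1 + z^2)^q H_j(z) for one family H_j ([hankel_span]).

    At x' = 0 the left-hand side is a limit as x' -> 0; it is the value at
    rho = 0 of the same integral because that integral is differentiable, hence
    continuous, in rho ([lim_punctured_enorm]). *)

Set Implicit Arguments.
Unset Strict Implicit.
Unset Printing Implicit Defensive.

Import Order.TTheory GRing.Theory Num.Theory.
Import numFieldNormedType.Exports.

Local Open Scope classical_set_scope.
Local Open Scope ring_scope.

Section HalfLine.
Context {R : realType}.
Implicit Types (a b c p q r s t u x y z nu rho sigma : R) (f g w : R -> R).

Local Notation mu := (@lebesgue_measure R).
Local Notation pos := (`]0%R, +oo[%classic : set R).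

(** * Dilations and Gamma integrals on the half-line *)

Lemma gt0_powRD x p q : 0 < x -> x `^ (p + q) = x `^ p * x `^ q.
Proof. by move=> x0; rewrite powRD// (gt_eqF x0) implybT. Qed.

Lemma measurable_pos : @measurable _ (measurableTypeR R) pos.
Proof. exact: measurable_itv. Qed.

(** The image of Lebesgue measure under x |-> c x, multiplied by c, gives each
    half-open interval its length, hence is Lebesgue measure. Working with
    measures rather than with antiderivatives fits integrands that are singular
    at 0, or that involve parametric integrals and are thus only known to be
    measurable. *)
Lemma ge0_integral_dilation (c : R) (f : R -> \bar R) : 0 < c ->
  measurable_fun pos f -> (forall x, 0 < x -> (0 <= f x)%E) ->
  (\int[mu]_(x in pos) f x
   = c%:E * \int[mu]_(x in pos) f (c * x)%R)%E.
Proof.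
move=> c0 mf f0.
have mc : measurable_fun [set: measurableTypeR R]
    ( *%R c : measurableTypeR R -> measurableTypeR R) := mulrl_measurable c.
pose nu0 : {measure set (measurableTypeR R) -> \bar R} :=
  pushforward mu (( *%R c) : R -> measurableTypeR R).
pose nu : {measure set (measurableTypeR R) -> \bar R} :=
  mscale (NngNum (ltW c0)) (nu0 mc).
have nuE A : measurable A -> lebesgue_measure A = nu A.
  apply: (@lebesgue_measure_unique R nu) => // _ [[a b]] _ <-.
  have -> : nu `]a, b]%classic = (c%:E * mu `](a / c)%R, (b / c)%R]%classic)%E.
    rewrite /nu /mscale/= /pushforward; congr (_ * mu _)%E.
    apply/seteqP; split=> x /=; rewrite !in_itv/= ltr_pdivrMr// ler_pdivlMr//;
      by rewrite [x * c]mulrC.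
  rewrite !lebesgue_measure_itv/= !lte_fin ltr_pM2r ?invr_gt0//.
  case: ifPn => ab; last by rewrite mule0.
  by rewrite !EFinN -!EFinD -EFinM -mulrBl mulrCA mulfV ?mulr1// gt_eqF.
have f0' x : pos x -> (0 <= f x)%E.
  by rewrite /= in_itv/= andbT; exact: f0.
rewrite (eq_measure_integral nu) => [|A mA _]; last exact: nuE.
rewrite ge0_integral_mscale//; congr (_ * _)%E.
rewrite ge0_integral_pushforward//=; last by move=> x; rewrite inE; exact: f0'.
congr (integral _ _ _); apply/seteqP; split=> x /=;
  by rewrite !in_itv/= !andbT pmulr_rgt0.
Qed.

Lemma measurable_dilation c f : 0 < c ->
  measurable_fun pos f -> measurable_fun pos (fun x => f (c * x)).
Proof.
move=> c0 mf; apply: (measurable_comp (F := pos) _ _ mf) => //.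
  by move=> _ [x /= + <-]; rewrite !in_itv/= !andbT => x0; rewrite mulr_gt0.
Qed.

Lemma integrable_dilation (c : R) (f : R -> R) : 0 < c ->
  mu.-integrable pos (EFin \o f) ->
  mu.-integrable pos (EFin \o (fun x => f (c * x))).
Proof.
move=> c0 /integrableP[/measurable_EFinP mf intf]; apply/integrableP; split.
  by apply/measurable_EFinP; exact: (measurable_dilation c0 mf).
move: intf; rewrite (ge0_integral_dilation (c := c))//; last first.
  by apply: measurableT_comp => //; exact/measurable_EFinP.
rewrite !ltey; apply: contra => /eqP ->.
by rewrite gt0_muley// lte_fin.
Qed.

Lemma Rintegral_dilation (c : R) (f : R -> R) : 0 < c ->
  mu.-integrable pos (EFin \o f) ->
  \int[mu]_(x in pos) f x
  = c * \int[mu]_(x in pos) f (c * x).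
Proof.
move=> c0 intf; have intfc := integrable_dilation c0 intf.
rewrite /Rintegral [X in fine X = _]integralE [X in _ = _ * fine X]integralE.
have [mf _] := integrableP _ _ _ intf.
rewrite (ge0_integral_dilation (c := c))//; last exact: measurable_funepos.
rewrite (ge0_integral_dilation (f := (EFin \o f)^\-%E) (c := c))//; last first.
  exact: measurable_funeneg.
pose fc := EFin \o (fun x => f (c * x)).
have -> : (\int[mu]_(x in pos) (EFin \o f)^\+ (c * x)%R
    = \int[mu]_(x in pos) fc^\+ x)%E.
  by apply: eq_integral => x _; rewrite !funeposE.
have -> : (\int[mu]_(x in pos) (EFin \o f)^\- (c * x)%R
    = \int[mu]_(x in pos) fc^\- x)%E.
  by apply: eq_integral => x _; rewrite !funenegE.
have P_fin := integrable_pos_fin_num measurable_pos intfc.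
have N_fin := integrable_neg_fin_num measurable_pos intfc.
transitivity (c * fine (\int[mu]_(x in pos) fc^\+ x
    - \int[mu]_(x in pos) fc^\- x)%E); last by [].
by rewrite -(fineK P_fin) -(fineK N_fin) -!EFinM -!EFinB/= mulrBr.
Qed.

Lemma measurable_gamma_integrand p (D : set R) :
  measurable_fun D (fun t => t `^ (p - 1) * expR (- t)).
Proof.
apply: measurable_funTS; apply: measurable_funM.
  exact: measurable_powR.
by apply: measurableT_comp => //; exact: measurable_expR.
Qed.

(** Comes from e^(t/p) >= (t/(2p))^2; the right-hand side tends to 0 when t
    tends to +oo. *)
Lemma powR_expRN_le p t : 0 < p -> 0 < t ->
  t `^ p * expR (- t) <= (4 * p ^+ 2) `^ p * t^-1 `^ p.
Proof.
move=> p0 t0.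
have -> : expR (- t) = expR (- (t / p)) `^ p.
  by rewrite -expRM mulNr divfK ?gt_eqF.
have t0' : 0 <= t^-1 by rewrite invr_ge0 ltW.
have p20 : 0 <= 4 * p ^+ 2 by rewrite mulr_ge0// sqr_ge0.
rewrite -!powRM ?expR_ge0//; last exact: ltW.
apply: ge0_ler_powR; rewrite ?nnegrE ?mulr_ge0 ?expR_ge0 ?(ltW p0) ?(ltW t0)//.
rewrite expRN ler_pdivrMr ?expR_gt0//.
have -> : t / p = t / (2 * p) + t / (2 * p) by field; rewrite gt_eqF.
rewrite expRD.
have h : t / (2 * p) <= expR (t / (2 * p)).
  by apply: le_trans (expR_ge1Dx _); rewrite lerDr.
have h0 : 0 <= t / (2 * p) by rewrite divr_ge0 ?mulr_ge0// ltW.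
apply: le_trans (_ : 4 * p ^+ 2 / t * (t / (2 * p) * (t / (2 * p))) <= _).
  rewrite le_eqVlt; apply/orP; left; apply/eqP.
  by field; rewrite !gt_eqF.
by apply: ler_wpM2l; [exact: mulr_ge0 | exact: ler_pM].
Qed.

Lemma cvg_inv_powR p : 0 < p -> (n.+2%:R^-1 : R) `^ p @[n --> \oo] --> (0 : R).
Proof.
move=> p0; have /cvg_at_rightP := powR_cvg0 p0; apply; split=> //.
have := @cvg_harmonic R; rewrite -(cvg_shiftn 1).
by under eq_fun do rewrite addn1.
Qed.

Lemma bigcup_segments :
  \bigcup_n (`[n.+2%:R^-1, n.+2%:R]%classic : set R) = pos.
Proof.
apply/seteqP; split => [x [n _]|x] /=; rewrite !in_itv/= andbT.
  by move=> /andP[+ _]; apply: lt_le_trans; rewrite invr_gt0.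
move=> x0; have x0' : 0 < x^-1 by rewrite invr_gt0.
pose n := maxn (Num.trunc x) (Num.trunc x^-1).
have h y : 0 < y -> (Num.trunc y <= n)%N -> y <= n.+2%:R.
  move=> y0 yn; apply: ltW; apply: (lt_le_trans (truncnS_gt y)).
  by rewrite ler_nat ltnS (leq_trans yn).
exists n => //=; rewrite in_itv/= h ?leq_maxl// andbT.
by rewrite invf_ple ?posrE// h ?leq_maxr.
Qed.

Lemma within_continuous_derivable f (A : set R) :
  (forall x, A x -> derivable f x 1) -> {within A, continuous f}.
Proof.
move=> df; apply: continuous_in_subspaceT => x /set_mem Ax.
by apply: differentiable_continuous; exact/derivable1_diffP/df.
Qed.

Lemma derivable_segment_LRcontinuous f a c : a < c ->
  (forall x, a <= x <= c -> derivable f x 1) -> derivable_oo_LRcontinuous f a c.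
Proof.
move=> ac df.
have cf x : a <= x <= c -> {for x, continuous f}.
  by move=> /df/derivable1_diffP/differentiable_continuous.
split.
- by move=> x; rewrite in_itv/= => /andP[/ltW ? /ltW ?]; apply: df; apply/andP.
- by apply: cvg_at_right_filter; apply: cf; rewrite lexx ltW.
- by apply: cvg_at_left_filter; apply: cf; rewrite lexx ltW.
Qed.

Lemma is_derive_NexpRN x : is_derive x 1 (fun t => - expR (- t)) (expR (- x)).
Proof.
have h : is_derive x 1 (expR \o -%R) (expR (- x) * - 1).
  by apply: is_derive1_comp; apply: is_deriveN.
have -> : expR (- x) = - (expR (- x) * - 1) by rewrite mulrN1 opprK.
exact: is_deriveN.
Qed.

Lemma continuous_expRN : continuous (fun t : R => expR (- t)).
Proof.
move=> x.
by apply: continuous_comp; [exact: opp_continuous | exact: continuous_expR].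
Qed.

(** Euler's integral with values in [0, +oo], so that the functional equation
    can be established before finiteness, and finiteness deduced from it. *)
Definition gammaE p := (\int[mu]_(t in pos) (t `^ (p - 1) * expR (- t))%:E)%E.

(** Integration by parts on the segments [1/N, N], where everything is smooth,
    followed by monotone convergence on both sides. *)
Lemma gammaE_succ p : 0 < p -> gammaE (p + 1) = (p%:E * gammaE p)%E.
Proof.
move=> p0.
pose seg n : set R := `[n.+2%:R^-1, n.+2%:R]%classic.
have seg_gt0 n x : seg n x -> 0 < x.
  by rewrite /seg/= in_itv/= => /andP[+ _]; apply: lt_le_trans; rewrite invr_gt0.
have ab n : (n.+2%:R^-1 < n.+2%:R :> R).
  by rewrite (@lt_trans _ _ 1)// ?invf_lt1// ltr1n.
have nd : nondecreasing_seq seg.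
  move=> m n mn; rewrite subsetEset => x; rewrite /seg/= !in_itv/= => /andP[h1 h2].
  have mn' : (m.+2%:R <= n.+2%:R :> R) by rewrite ler_nat !ltnS.
  rewrite (le_trans h2)// andbT (le_trans _ h1)// lef_pV2 ?posrE//.
have cvgG q : (\int[mu]_(t in seg n) (t `^ (q - 1) * expR (- t))%:E)%E
    @[n --> \oo] --> gammaE q.
  rewrite /gammaE -bigcup_segments; apply: ge0_nondecreasing_set_cvg_integral => //.
  - by move=> n; exact: measurable_itv.
  - by move=> n; apply/measurable_EFinP; exact: measurable_gamma_integrand.
  - by move=> n x _; rewrite lee_fin mulr_ge0 ?powR_ge0 ?expR_ge0.
(* bd n is the boundary term of the integration by parts on [1/N, N],
   where N = n + 2. *)
pose bd (n : nat) : R := n.+2%:R^-1 `^ p * expR (- n.+2%:R^-1)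
   - n.+2%:R `^ p * expR (- n.+2%:R).
have bd0 : bd n @[n --> \oo] --> (0 : R).
  rewrite -[X in _ --> X](subrr 0); apply: cvgB.
    apply: (@squeeze_cvgr _ _ _ _ (cst 0) (fun n => n.+2%:R^-1 `^ p)).
    - near=> n; rewrite mulr_ge0 ?powR_ge0 ?expR_ge0//=.
      by rewrite ler_piMr ?powR_ge0// expR_le1 oppr_le0 invr_ge0.
    - exact: cvg_cst.
    - exact: cvg_inv_powR.
  apply: (@squeeze_cvgr _ _ _ _ (cst 0)
      (fun n => (4 * p ^+ 2) `^ p * n.+2%:R^-1 `^ p)).
  - near=> n; rewrite mulr_ge0 ?powR_ge0 ?expR_ge0//=.
    exact: powR_expRN_le.
  - exact: cvg_cst.
  - rewrite -[X in _ --> X](mulr0 ((4 * p ^+ 2) `^ p)).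
    by apply: cvgMr; exact: cvg_inv_powR.
have d_pow x : 0 < x -> is_derive x 1 (@powR R ^~ p) (p * x `^ (p - 1)).
  exact: is_derive1_powR.
have ibp n : (\int[mu]_(t in seg n) (t `^ (p + 1 - 1) * expR (- t))%:E
    = (bd n)%:E
      + p%:E * \int[mu]_(t in seg n) (t `^ (p - 1) * expR (- t))%:E)%E.
  under eq_integral do rewrite addrK.
  have cpow q : {within seg n, continuous (@powR R ^~ q)}.
    apply: within_continuous_derivable => x /seg_gt0 x0.
    by have [] := is_derive1_powR q x0.
  have cexp : {within seg n, continuous (fun t => expR (- t))}.
    exact: continuous_subspaceT continuous_expRN.
  have intg : mu.-integrable (seg n)
      (fun t => (t `^ (p - 1) * expR (- t))%:E).
    apply: continuous_compact_integrable; first exact: segment_compact.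
    by move=> x; apply: cvgM; [exact: cpow | exact: cexp].
  rewrite (@integration_by_parts R (@powR R ^~ p) (fun t => - expR (- t))
     (fun t => p * t `^ (p - 1)) (fun t => expR (- t)) _ _ (ab n)).
  - rewrite (_ : (fun t => _) = (fun t => (- p)%:E
        * (t `^ (p - 1) * expR (- t))%:E)%E); last first.
      by apply/funext => t; rewrite -EFinM; congr EFin; ring.
    rewrite integralZl//.
    rewrite EFinN mulNe oppeK; congr (_%:E + _)%E.
    by rewrite /bd; ring.
  - by move=> x; apply: cvgM; [exact: cvg_cst | exact: cpow].
  - apply: derivable_segment_LRcontinuous => // x xs.
    by have [] := d_pow x (seg_gt0 n x xs).
  - move=> x /subset_itv_oo_cc/seg_gt0 x0.
    by rewrite derive1E; have [_ ->] := d_pow x x0.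
  - exact: cexp.
  - by apply: derivable_segment_LRcontinuous => // x xs; have [] := is_derive_NexpRN x.
  - by move=> x _; rewrite derive1E; have [_ ->] := is_derive_NexpRN x.
have := cvgG (p + 1).
have -> : (fun n => \int[mu]_(t in seg n) (t `^ (p + 1 - 1) * expR (- t))%:E)%E
  = (fun n => (bd n)%:E
      + p%:E * \int[mu]_(t in seg n) (t `^ (p - 1) * expR (- t))%:E)%E.
  exact/funext.
move=> /cvg_lim <- //; apply/cvg_lim => //.
rewrite -[X in _ --> X]add0e; apply: cvgeD.
- by [].
- by apply: cvg_EFin; [exact: nearW | exact: bd0].
- by apply: cvgeZl => //; exact: cvgG.
Unshelve. all: by end_near.
Qed.

Lemma gammaE_ge0 p : (0 <= gammaE p)%E.
Proof.
by apply: integral_ge0 => t _; rewrite lee_fin mulr_ge0 ?powR_ge0 ?expR_ge0.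
Qed.

Lemma gammaE_1_lty : (gammaE 1 < +oo)%E.
Proof.
apply: (@le_lt_trans _ _ (\int[mu]_(t in `[0%R, +oo[) (expR (- t))%:E)%E).
  rewrite /gammaE; under eq_integral do rewrite subrr powRr0 mul1r.
  apply: ge0_subset_integral => //.
  - by apply/measurable_EFinP/measurableT_comp => //; exact: measurable_expR.
  - by apply: subset_itv; rewrite bnd_simp.
rewrite (@ge0_continuous_FTC2y R _ (fun t => - expR (- t)) 0 0).
- by rewrite -EFinB ltry.
- by move=> x _; exact: expR_ge0.
- exact: continuous_subspaceT continuous_expRN.
- by rewrite -oppr0; apply: cvgN; exact: cvgr_expR.
- by move=> x _; have [] := is_derive_NexpRN x.
- apply: cvg_at_right_filter.
  by have [/derivable1_diffP/differentiable_continuous] := is_derive_NexpRN 0.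
- by move=> x _; rewrite derive1E; have [_ ->] := is_derive_NexpRN x.
Qed.

(** The functional equation carries finiteness from p = 1 to the positive
    integers; then p >= 1 follows from t^(p-1) <= 1 + t^N, and p > 0 by one more
    use of the functional equation. *)
Lemma gammaE_lty p : 0 < p -> (gammaE p < +oo)%E.
Proof.
have gnat n : (gammaE n.+1%:R < +oo)%E.
  elim: n => [|n ih]; first exact: gammaE_1_lty.
  by rewrite -natr1 gammaE_succ// lte_mul_pinfty.
have g1 q : 1 <= q -> (gammaE q < +oo)%E.
  move=> q1; pose n := Num.trunc q.
  apply: (@le_lt_trans _ _ (gammaE 1 + gammaE n.+2%:R)%E); last first.
    by rewrite lte_add_pinfty// gammaE_1_lty.
  rewrite /gammaE -ge0_integralD//=; last 4 first.
  - by move=> t _; rewrite lee_fin mulr_ge0 ?powR_ge0 ?expR_ge0.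
  - by apply/measurable_EFinP; exact: measurable_gamma_integrand.
  - by move=> t _; rewrite lee_fin mulr_ge0 ?powR_ge0 ?expR_ge0.
  - by apply/measurable_EFinP; exact: measurable_gamma_integrand.
  apply: ge0_le_integral => //=.
  - by move=> t _; rewrite lee_fin mulr_ge0 ?powR_ge0 ?expR_ge0.
  - by apply/measurable_EFinP; exact: measurable_gamma_integrand.
  - by apply: emeasurable_funD; apply/measurable_EFinP; exact: measurable_gamma_integrand.
  move=> t; rewrite /= in_itv/= andbT => t0; rewrite -EFinD lee_fin -mulrDl.
  rewrite ler_wpM2r ?expR_ge0// subrr powRr0.
  have [t1|/ltW t1] := leP t 1.
    rewrite ler_wpDr ?powR_ge0// -[leRHS](powRr0 t).
    by apply: ger_powR; rewrite ?t0 ?subr_ge0.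
  rewrite ler_wpDl//; apply: ler_powR => //.
  by rewrite lerB// (le_trans (ltW (truncnS_gt q)))// ler_nat ltnS leqnSn //.
move=> p0; have := g1 (p + 1); rewrite lerDr => /(_ (ltW p0)).
rewrite gammaE_succ// !ltey; apply: contra => /eqP ->.
by rewrite gt0_muley// lte_fin.
Qed.

Lemma GammaE p : 0 < p -> gammaE p = (Gamma p)%:E.
Proof.
by move=> p0; rewrite /Gamma fineK// ge0_fin_numE ?gammaE_ge0// gammaE_lty.
Qed.

Lemma Gamma_succ p : 0 < p -> Gamma (p + 1) = p * Gamma p.
Proof.
move=> p0; apply: EFin_inj.
by rewrite EFinM -!GammaE ?gammaE_succ// addr_gt0.
Qed.

(** A bound below that is uniform in p, by restricting the integral to [1, 2]; it
    serves to compare the Bessel series with the exponential series. *)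
Lemma Gamma_ge p : 1 <= p -> expR (- 2) <= Gamma p.
Proof.
move=> p1; have p0 : 0 < p by rewrite (lt_le_trans _ p1).
rewrite -lee_fin -GammaE//.
have <- : (\int[mu]_(t in `[1%R, 2%R]) (expR (- 2))%:E = (expR (- 2))%:E)%E.
  rewrite integral_cst//= lebesgue_measure_itv/= lte_fin ltr1n.
  by rewrite -EFinB (_ : 2 - 1 = 1) ?mule1//; ring.
apply: le_trans (_ : (\int[mu]_(t in `[1%R, 2%R])
    (t `^ (p - 1) * expR (- t))%:E <= _)%E).
  apply: ge0_le_integral => //=.
  - by apply/measurable_EFinP; exact: measurable_gamma_integrand.
  - move=> t; rewrite in_itv/= => /andP[t1 t2]; rewrite lee_fin.
    rewrite -[leLHS]mul1r ler_pM ?expR_ge0 ?ler_expR ?lerN2//.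
    by rewrite -[leLHS](powRr0 t) ler_powR// subr_ge0.
apply: ge0_subset_integral => //.
- by apply/measurable_EFinP; exact: measurable_gamma_integrand.
- by move=> t _; rewrite lee_fin mulr_ge0 ?powR_ge0 ?expR_ge0.
- by apply: subset_itv; rewrite bnd_simp.
Qed.

Lemma Gamma_gt0 p : 1 <= p -> 0 < Gamma p.
Proof. by move/Gamma_ge; apply: lt_le_trans; exact: expR_gt0. Qed.

Lemma integrable_gamma p a : 0 < p -> 0 < a ->
  mu.-integrable pos (EFin \o (fun t => t `^ (p - 1) * expR (- (a * t)))).
Proof.
move=> p0 a0.
have int1 : mu.-integrable pos (EFin \o (fun t => t `^ (p - 1) * expR (- t))).
  apply/integrableP; split.
    by apply/measurable_EFinP; exact: measurable_gamma_integrand.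
  apply: le_lt_trans (gammaE_lty p0); rewrite le_eqVlt; apply/orP; left.
  apply/eqP; apply: eq_integral => t _ /=.
  by rewrite ger0_norm// mulr_ge0 ?powR_ge0 ?expR_ge0.
have := integrable_dilation a0 int1.
move=> /(integrableZl measurable_pos ((a `^ (p - 1))^-1)).
apply: eq_integrable => // t; rewrite inE/= in_itv/= andbT => t0.
rewrite -EFinM powRM ?ltW// -[in LHS]mulrA mulKf//.
by rewrite gt_eqF// powR_gt0.
Qed.

Lemma Rintegral_gamma p a : 0 < p -> 0 < a ->
  \int[mu]_(t in pos) (t `^ (p - 1) * expR (- (a * t))) = Gamma p / a `^ p.
Proof.
move=> p0 a0.
rewrite (Rintegral_dilation (c := a^-1)) ?invr_gt0//; last first.
  exact: integrable_gamma.
have -> : Gamma p / a `^ p = a `^ (- p) * Gamma p by rewrite powRN mulrC.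
rewrite (_ : a `^ (- p) = a^-1 * a `^ (1 - p)); last first.
  by rewrite -(powR_inv1 (ltW a0)) -gt0_powRD//; congr (_ `^ _); ring.
rewrite -mulrA; congr (_ * _); rewrite -RintegralZl//; last first.
  have := integrable_gamma p0 ltr01.
  by apply: eq_integrable => // t _ /=; rewrite mul1r.
apply: eq_Rintegral => t; rewrite inE/= in_itv/= andbT => t0.
rewrite mulrA divff ?gt_eqF// mul1r powRM ?invr_ge0 ?ltW//.
rewrite mulrA; congr (_ * _ * _).
by rewrite -(powR_inv1 (ltW a0)) -powRrM; congr (_ `^ _); ring.
Qed.

(** * The normalized Bessel function *)

Definition clifford_coef nu k : R :=
  (-1) ^+ k / (k`!%:R * Gamma (k%:R + nu + 1)).

(** The Bessel-Clifford function of order nu at -u. Passing from J_nu(z) to the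
    variable u = (z/2)^2 removes the factor z^nu and makes differentiation a mere
    shift of the index nu. *)
Definition clifford nu u : R := limn (pseries (clifford_coef nu) u).

Lemma is_cvg_clifford nu u : 0 <= nu -> cvgn (pseries (clifford_coef nu) u).
Proof.
move=> nu0; apply: normed_cvg.
apply: (@series_le_cvg _ _ (fun k => expR 2 * exp_coeff `|u| k)) => [k|k|k|].
- exact: normr_ge0.
- by rewrite mulr_ge0 ?expR_ge0// exp_coeff_ge0.
- have Gk : expR (- 2) <= Gamma (k%:R + nu + 1) by rewrite Gamma_ge// lerDr addr_ge0.
  have G0 : 0 < Gamma (k%:R + nu + 1) := lt_le_trans (expR_gt0 _) Gk.
  rewrite /clifford_coef /exp_coeff/= normrM normrX normf_div normrX normrN1 expr1n div1r.
  rewrite normrM invfM [`|k`!%:R|]gtr0_norm ?ltr0n ?fact_gt0//.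
  rewrite [`|Gamma _|]gtr0_norm// mulrC.
  have iG : (Gamma (k%:R + nu + 1))^-1 <= expR 2.
    by rewrite -[expR 2]invrK -expRN lef_pV2 ?posrE ?expR_gt0.
  rewrite [leLHS]mulrA [leRHS](_ : _ = `|u| ^+ k / k`!%:R * expR 2); last by ring.
  by apply: ler_wpM2l; rewrite // mulr_ge0 ?exprn_ge0// invr_ge0.
- by apply: is_cvg_seriesZ; exact: is_cvg_series_exp_coeff.
Qed.

Lemma clifford_coef_diffs nu :
  pseries_diffs (clifford_coef nu) = (fun k => - clifford_coef (nu + 1) k).
Proof.
apply/funext => k; rewrite /pseries_diffs /clifford_coef.
rewrite (_ : k.+1%:R + nu + 1 = k%:R + (nu + 1) + 1); last by rewrite -natr1; ring.
rewrite factS natrM exprS !mulN1r !mulNr mulrN; congr (- _).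
by rewrite mulrCA -[k.+1%:R * _ * _]mulrA invfM mulVKf// pnatr_eq0.
Qed.

Lemma is_derive_clifford nu u : 0 <= nu ->
  is_derive u 1 (clifford nu) (- clifford (nu + 1) u).
Proof.
move=> nu0.
have nu1 : 0 <= nu + 1 by rewrite addr_ge0.
have psN (c : nat -> R) x : pseries (fun k => - c k) x = - pseries c x.
  by apply/funext => k; rewrite /pseries /series/=;
    under eq_bigr do rewrite mulNr; rewrite sumrN.
have := @pseries_snd_diffs R (clifford_coef nu) (`|u| + 1) u.
rewrite clifford_coef_diffs.
rewrite (_ : pseries_diffs (fun k => - _) = clifford_coef (nu + 1 + 1)); last first.
  rewrite -[X in pseries_diffs X]/(- clifford_coef (nu + 1)).
  by rewrite pseries_diffsN clifford_coef_diffs; apply/funext => k; rewrite opprK.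
rewrite !psN (limN (@is_cvg_clifford (nu + 1) u nu1)).
apply.
- exact: is_cvg_clifford.
- by apply: is_cvgN; exact: is_cvg_clifford.
- by apply: is_cvg_clifford; rewrite addr_ge0.
- by rewrite [ltRHS]ger0_norm ?addr_ge0// ltrDl.
Qed.

(** The same combination of partial sums, those of c0 and c1 being taken one term
    further, vanishes identically. *)
Lemma pseries_three_term (c0 c1 c2 : nat -> R) (l0 l1 l2 a u : R) :
  (forall k, c0 k = (k%:R + a) * c1 k) ->
  (forall k, c2 k = - k.+1%:R * c1 k.+1) ->
  pseries c0 u @ \oo --> l0 -> pseries c1 u @ \oo --> l1 ->
  pseries c2 u @ \oo --> l2 ->
  u * l2 - a * l1 + l0 = 0.
Proof.
move=> c0E c2E cv0 cv1 cv2.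
have S (c : nat -> R) m : pseries c u m.+1 = pseries c u m + c m * u ^+ m.
  by rewrite /pseries /series/= big_nat_recr.
have S0 (c : nat -> R) : pseries c u 0%N = 0 by rewrite /pseries /series/= big_geq.
have E n : u * pseries c2 u n - a * pseries c1 u n.+1 + pseries c0 u n.+1 = 0.
  elim: n => [|n ih].
    by rewrite !(S _ 0%N) !S0 c0E; ring.
  rewrite (S c1) (S c0 n.+1) (S c2) c2E c0E exprS -natr1 -[RHS]ih.
  by ring.
have lim0 : u * pseries c2 u n - a * pseries c1 u n.+1 + pseries c0 u n.+1
    @[n --> \oo] --> u * l2 - a * l1 + l0.
  apply: cvgD; last by rewrite (cvg_shiftS (pseries c0 u)).
  apply: cvgB; first exact: cvgMr.
  by apply: cvgMr; rewrite (cvg_shiftS (pseries c1 u)).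
rewrite -(cvg_lim _ lim0)//; apply/cvg_lim => //.
by under eq_fun do rewrite E; exact: cvg_cst.
Qed.

(** This is Bessel's equation u g'' + (nu + 1) g' + g = 0, written with
    g' = - clifford (nu + 1). *)
Lemma clifford_recurrence nu u : 0 <= nu ->
  u * clifford (nu + 1 + 1) u - (nu + 1) * clifford (nu + 1) u + clifford nu u = 0.
Proof.
move=> nu0; apply: (@pseries_three_term (clifford_coef nu)
  (clifford_coef (nu + 1)) (clifford_coef (nu + 1 + 1))).
- move=> k; have k1 : 1 <= k%:R + nu + 1 by rewrite lerDr addr_ge0.
  have k0 : k%:R + nu + 1 != 0 by rewrite gt_eqF// (lt_le_trans _ k1).
  rewrite /clifford_coef (_ : k%:R + (nu + 1) + 1 = k%:R + nu + 1 + 1); last by ring.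
  rewrite (@Gamma_succ (k%:R + nu + 1)) ?(lt_le_trans _ k1)//.
  by rewrite addrA; field; rewrite k0 gt_eqF ?Gamma_gt0//=.
- move=> k.
  have := congr1 (fun f : nat -> R => f k) (clifford_coef_diffs (nu + 1)).
  by rewrite /pseries_diffs mulNr => ->; rewrite opprK.
- exact: is_cvg_clifford.
- by apply: is_cvg_clifford; rewrite addr_ge0.
- by apply: is_cvg_clifford; rewrite !addr_ge0.
Qed.

Lemma clifford0 nu : clifford nu 0 = (Gamma (nu + 1))^-1.
Proof.
apply/cvg_lim => //; rewrite -(cvg_shiftn 1)/=.
apply: cvg_near_cst; near=> n.
rewrite /pseries /series/= addn1 big_nat_recl// big1 => [|i _].
  by rewrite addr0 expr0 /clifford_coef expr0 fact0 !mul1r mulr1 add0r.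
by rewrite exprS mul0r mulr0.
Unshelve. all: by end_near. Qed.

Lemma is_derive_energy f g x (df dg : R) :
  is_derive x 1 f df -> is_derive x 1 g dg ->
  is_derive x 1 (fun t => f t ^+ 2 + t * g t ^+ 2)
    (2 * f x * df + (g x ^+ 2 + x * (2 * g x * dg))).
Proof.
move=> d_f d_g.
by apply: is_derive_eq; rewrite /GRing.scale/=; ring.
Qed.

(** In the variable z, with u = (z/2)^2, the left-hand side is y^2 + y'^2 for the
    solution y(z) = clifford nu ((z/2)^2) of y'' + (2 nu + 1)/z y' + y = 0: the
    friction term makes the energy of the oscillator decrease. *)
Lemma clifford_energy nu u : 0 <= nu -> 0 <= u ->
  clifford nu u ^+ 2 + u * clifford (nu + 1) u ^+ 2 <= clifford nu 0 ^+ 2.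
Proof.
move=> nu0 u0; have nu1 : 0 <= nu + 1 by rewrite addr_ge0.
pose E x := clifford nu x ^+ 2 + x * clifford (nu + 1) x ^+ 2.
have dE x : is_derive x 1 E (- (2 * nu + 1) * clifford (nu + 1) x ^+ 2).
  have := is_derive_energy (is_derive_clifford x nu0) (is_derive_clifford x nu1).
  congr is_derive; have := clifford_recurrence x nu0.
  move: (clifford _ _) (clifford _ _) (clifford _ _) => a b c h.
  have -> : a = (nu + 1) * b - x * c by apply: subr0_eq; rewrite -h; ring.
  by ring.
have -> : clifford nu 0 ^+ 2 = E 0 by rewrite /E mul0r addr0.
rewrite -/(E u).
apply: (@ler0_derive1_nincry _ E 0) => //.
- move=> x _; rewrite derive1E; have [_ ->] := dE x.
  by rewrite mulNr oppr_le0 mulr_ge0 ?sqr_ge0// addr_ge0// mulr_ge0.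
- apply: within_continuous_derivable => x _.
  by have [] := dE x.
Qed.

Lemma clifford_bounded nu u : 0 <= nu -> 0 <= u ->
  `|clifford nu u| <= (Gamma (nu + 1))^-1.
Proof.
move=> nu0 u0.
have g0 : 0 <= (Gamma (nu + 1))^-1 by rewrite invr_ge0 ltW// Gamma_gt0// lerDr.
rewrite -(@ler_pXn2r _ 2)// ?nnegrE// real_normK ?num_real// -clifford0.
by apply: le_trans (clifford_energy nu0 u0); rewrite lerDl mulr_ge0 ?sqr_ge0.
Qed.

Lemma besselJE nu z : 0 <= nu -> 0 < z ->
  besselJ nu z = (z / 2) `^ nu * clifford nu ((z / 2) ^+ 2).
Proof.
move=> nu0 z0; have z2 : 0 < z / 2 by rewrite divr_gt0.
rewrite /besselJ /clifford.
rewrite (_ : series _ =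
    (fun n => (z / 2) `^ nu * pseries (clifford_coef nu) ((z / 2) ^+ 2) n)).
  by apply/cvg_lim => //; apply: cvgMr; exact: is_cvg_clifford.
apply/funext => n; rewrite /pseries /series/= mulr_sumr; apply: eq_bigr => i _.
rewrite gt0_powRD// -natrM powR_mulrn ?ltW// -exprM mulnC.
by rewrite /GRing.scale/= /clifford_coef; ring.
Qed.

(** * Pointwise estimates of the kernel *)

Definition kern_num s r sigma := sigma `^ s * (sigma + 2 * r) `^ s.

(** The integrand of I_s without the exponential and the constants; [kern_main]
    is what remains of it when only the dominant term of the denominator is
    kept. *)
Definition kern_full b s (e : bool) r sigma :=
  kern_num s r sigma / Normc.normc (Idenom b s e r sigma) ^+ 2.

Definition kern_main b s r sigma := kern_num s r sigma / (b * (sigma + r)) ^+ 2.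

Lemma normc_IdenomE b s (e : bool) r sigma :
  Normc.normc (Idenom b s e r sigma) ^+ 2
  = (kern_num s r sigma * cos (pi * s) - (-1) ^+ e * (b * (sigma + r))) ^+ 2
    + (kern_num s r sigma * sin (pi * s)) ^+ 2.
Proof.
rewrite /Idenom /kern_num /Normc.normc/= sqr_sqrtr ?addr_ge0 ?sqr_ge0//.
by congr (_ ^+ 2 + _ ^+ 2); ring.
Qed.

Lemma kern_num_ge0 s r sigma : 0 <= kern_num s r sigma.
Proof. by rewrite mulr_ge0 ?powR_ge0. Qed.

(** Separates the variables in a negative power of sigma + r, so that double
    integrals become products of Gamma integrals. *)
Lemma powR_le_add p q r sigma : 0 < r -> 0 < sigma -> p <= 0 -> q <= 0 ->
  (sigma + r) `^ (p + q) <= r `^ p * sigma `^ q.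
Proof.
move=> r0 s0 p0 q0.
have h x t : 0 < x -> x <= sigma + r -> t <= 0 -> (sigma + r) `^ t <= x `^ t.
  move=> x0 xl t0; rewrite -[t]opprK ![_ `^ (- - _)]powRN.
  rewrite lef_pV2 ?posrE ?powR_gt0 ?addr_gt0//.
  by apply: ge0_ler_powR; rewrite ?oppr_ge0 ?nnegrE ?(ltW x0) ?addr_ge0 ?(ltW s0) ?(ltW r0).
rewrite gt0_powRD ?addr_gt0//.
by apply: ler_pM; rewrite ?powR_ge0//; apply: h; rewrite // ?lerDl ?lerDr ltW.
Qed.

Lemma kern_num_le s r sigma : 0 <= s -> 0 < r -> 0 < sigma ->
  kern_num s r sigma <= 2 `^ s * (sigma + r) `^ (2 * s).
Proof.
move=> s0 r0 g0; have sr : 0 < sigma + r by rewrite addr_gt0.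
rewrite (_ : 2 * s = s + s); last by ring.
rewrite gt0_powRD// mulrCA; apply: ler_pM; rewrite ?powR_ge0//.
  by apply: ge0_ler_powR; rewrite ?nnegrE ?lerDl ?(ltW g0) ?(ltW r0) ?(ltW sr).
rewrite -powRM ?(ltW sr)//.
apply: ge0_ler_powR; rewrite ?nnegrE ?mulr_ge0 ?addr_ge0 ?(ltW g0) ?(ltW r0) ?(ltW sr)//.
  by lra.
by lra.
Qed.

Section KernelBounds.
Variables (b s : R) (e : bool).
Hypotheses (b0 : 0 < b) (s0 : 0 < s) (s12 : s < 1 / 2).

Lemma sin_pis_gt0 : 0 < sin (pi * s).
Proof.
apply: sin_gt0_pi; rewrite mulr_gt0 ?pi_gt0//=.
by rewrite gtr_pMr ?pi_gt0// (lt_trans s12)// ltr_pdivrMr// mul1r ltr1n.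
Qed.

Lemma kern_numX_div_le k m r sigma : 0 < r -> 0 < sigma ->
  kern_num s r sigma ^+ k / (b * (sigma + r)) ^+ m
  <= (2 `^ s) ^+ k / b ^+ m * (sigma + r) `^ (2 * s * k%:R - m%:R).
Proof.
move=> r0 g0; have sr : 0 < sigma + r by rewrite addr_gt0.
rewrite gt0_powRD// powRN powR_mulrn ?(ltW sr)//.
rewrite [in leRHS]powRrM powR_mulrn ?powR_ge0//.
rewrite mulrACA -exprMn -invfM -exprMn.
apply: ler_wpM2r; first by rewrite invr_ge0 exprn_ge0// mulr_ge0// ?(ltW b0) ?(ltW sr).
by apply: lerXn2r; rewrite ?nnegrE ?kern_num_ge0 ?mulr_ge0 ?powR_ge0// kern_num_le ?(ltW s0).
Qed.

(** The exponent 2s - 2 is split evenly between r and sigma: s - 1 > -1 leaves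
    both integrals convergent at 0. *)
Lemma kern_main_le r sigma : 0 < r -> 0 < sigma ->
  kern_main b s r sigma
  <= 2 `^ s / b ^+ 2 * (r `^ (s - 1) * sigma `^ (s - 1)).
Proof.
move=> r0 g0; have := kern_numX_div_le 1 2 r0 g0; rewrite !expr1.
move=> /le_trans; apply; apply: ler_wpM2l.
  by rewrite divr_ge0 ?powR_ge0// exprn_ge0// ltW.
rewrite (_ : 2 * s * 1%:R - 2%:R = (s - 1) + (s - 1)); last by ring.
have s1 : s - 1 <= 0 by move: s12; lra.
exact: powR_le_add.
Qed.

(** The distance from A e^(i theta) to a real number B is at least the
    distance from B to the line spanned by e^(i theta), which is
    B |sin theta|. *)
Lemma normc_Idenom_ge r sigma : 0 < r -> 0 < sigma ->
  sin (pi * s) ^+ 2 * (b * (sigma + r)) ^+ 2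
  <= Normc.normc (Idenom b s e r sigma) ^+ 2.
Proof.
move=> r0 g0; rewrite normc_IdenomE.
set A := kern_num s r sigma; set B := b * _.
have := cos2Dsin2 (pi * s); set c := cos _; set d := sin _ => cd.
have e2 : ((-1) ^+ e) ^+ 2 = 1 :> R by rewrite sqrr_sign.
move: e2; set eps := (-1) ^+ e => e2.
rewrite -subr_ge0.
rewrite (_ : _ - _ = (A - eps * B * c) ^+ 2 ); first exact: sqr_ge0.
have -> : (A * c - eps * B) ^+ 2 + (A * d) ^+ 2 - d ^+ 2 * B ^+ 2
  = A ^+ 2 * (c ^+ 2 + d ^+ 2) - 2 * eps * A * B * c + eps ^+ 2 * B ^+ 2
    - d ^+ 2 * B ^+ 2 by ring.
rewrite cd e2 (_ : d ^+ 2 = 1 - c ^+ 2); last by rewrite -cd; ring.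
have -> : (A - eps * B * c) ^+ 2
  = A ^+ 2 - 2 * eps * A * B * c + eps ^+ 2 * (B * c) ^+ 2 by ring.
by rewrite e2; ring.
Qed.

Lemma kern_full_le r sigma : 0 < r -> 0 < sigma ->
  kern_full b s e r sigma
  <= (sin (pi * s) ^+ 2)^-1 * (2 `^ s / b ^+ 2) *
     (r `^ (s - 1) * sigma `^ (s - 1)).
Proof.
move=> r0 g0; have sr : 0 < sigma + r by rewrite addr_gt0.
have S0 := sin_pis_gt0.
rewrite -mulrA; apply: le_trans (_ : (sin (pi * s) ^+ 2)^-1 * kern_main b s r sigma <= _).
  rewrite /kern_main /kern_full mulrCA -invfM; apply: ler_wpM2l.
    exact: kern_num_ge0.
  have h := normc_Idenom_ge r0 g0.
  have h0 : 0 < sin (pi * s) ^+ 2 * (b * (sigma + r)) ^+ 2.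
    by rewrite mulr_gt0 ?exprn_gt0 ?mulr_gt0.
  by rewrite lef_pV2 ?posrE// (lt_le_trans h0).
apply: ler_wpM2l; first by rewrite invr_ge0 sqr_ge0.
exact: kern_main_le.
Qed.

(** With N the squared modulus of the denominator,
    |A/N - A/B^2| = A |B^2 - N| / (N B^2) and |B^2 - N| <= 2AB + A^2. Since N
    dominates sin(pi s)^2 times A^2, B^2 and therefore AB, both resulting terms
    are O(A^2/B^3), homogeneous of degree 4s - 3. That exponent is split as
    (2s - 2) + (2s - 1): integrability at sigma = 0 needs 2s - 1 > -1, while the
    factor r^(n-2) of the outer integral compensates r^(2s-2). *)
Lemma kern_diff_le r sigma : 0 < r -> 0 < sigma ->
  `|kern_full b s e r sigma - kern_main b s r sigma|
  <= 3 * (sin (pi * s) ^+ 2)^-1 * (2 `^ s) ^+ 2 / b ^+ 3 *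
     (r `^ (2 * s - 2) * sigma `^ (2 * s - 1)).
Proof.
move=> r0 g0; have sr : 0 < sigma + r by rewrite addr_gt0.
have S0 := sin_pis_gt0.
have A0 := kern_num_ge0 s r sigma.
have B0 : 0 < b * (sigma + r) by rewrite mulr_gt0.
have NB := normc_Idenom_ge r0 g0.
have NA : sin (pi * s) ^+ 2 * kern_num s r sigma ^+ 2
    <= Normc.normc (Idenom b s e r sigma) ^+ 2.
  by rewrite normc_IdenomE mulrC -exprMn lerDr sqr_ge0.
have N0 : 0 < Normc.normc (Idenom b s e r sigma) ^+ 2.
  by apply: lt_le_trans NB; rewrite mulr_gt0 ?exprn_gt0.
have BN : `|(b * (sigma + r)) ^+ 2 - Normc.normc (Idenom b s e r sigma) ^+ 2|
  <= 2 * kern_num s r sigma * (b * (sigma + r)) + kern_num s r sigma ^+ 2.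
  rewrite normc_IdenomE; move: A0 B0; set A := kern_num _ _ _; set B := b * _.
  clearbody A B => A0 B0.
  have -> : B ^+ 2 - ((A * cos (pi * s) - (-1) ^+ e * B) ^+ 2 + (A * sin (pi * s)) ^+ 2)
     = (2 * A * B) * ((-1) ^+ e * cos (pi * s)) - A ^+ 2.
    have e2 : ((-1) ^+ e) ^+ 2 = 1 :> R by rewrite sqrr_sign.
    have -> : (2 * A * B) * ((-1) ^+ e * cos (pi * s)) - A ^+ 2
      = B ^+ 2 - ((-1) ^+ e) ^+ 2 * B ^+ 2 + (2 * A * B) * ((-1) ^+ e * cos (pi * s))
        - A ^+ 2 * (cos (pi * s) ^+ 2 + sin (pi * s) ^+ 2).
      by rewrite cos2Dsin2 e2; ring.
    ring.
  apply: (le_trans (ler_normB _ _)); apply: lerD; last by rewrite ger0_norm ?sqr_ge0.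
  have AB0 : 0 <= 2 * A * B by rewrite !mulr_ge0 ?(ltW B0).
  rewrite (normrM (2 * A * B)) (ger0_norm AB0) ler_piMr//.
  by rewrite normrMsign ler_norml cos_geN1 cos_le1.
have key : `|kern_full b s e r sigma - kern_main b s r sigma|
  <= 3 * (sin (pi * s) ^+ 2)^-1
     * (kern_num s r sigma ^+ 2 / (b * (sigma + r)) ^+ 3).
  rewrite /kern_full /kern_main.
  move: A0 B0 NB NA N0 BN; set A := kern_num _ _ _; set B := b * _.
  set N := Normc.normc _ ^+ 2; set S := sin _ in S0 *.
  clearbody A B N S => A0 B0 NB NA N0 BN.
  have -> : A / N - A / B ^+ 2 = A / (N * B ^+ 2) * (B ^+ 2 - N).
    by field; rewrite !gt_eqF ?S0.
  rewrite normrM ger0_norm; last by rewrite divr_ge0// mulr_ge0 ?sqr_ge0 ?(ltW N0).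
  apply: le_trans (ler_wpM2l _ BN) _.
    by rewrite divr_ge0// mulr_ge0 ?sqr_ge0 ?(ltW N0).
  rewrite mulrAC ler_pdivrMr ?mulr_gt0 ?exprn_gt0//.
  rewrite [leRHS](_ : _ = 3 * A ^+ 2 * N / (S ^+ 2 * B)); last first.
    by field; rewrite !gt_eqF.
  rewrite ler_pdivlMr ?mulr_gt0 ?exprn_gt0//.
  have AB : S ^+ 2 * (A * B) <= N.
    have : 0 <= S ^+ 2 * (A - B) ^+ 2 by rewrite mulr_ge0 ?sqr_ge0.
    have -> : S ^+ 2 * (A - B) ^+ 2
      = S ^+ 2 * A ^+ 2 + S ^+ 2 * B ^+ 2 - 2 * (S ^+ 2 * (A * B)) by ring.
    by move: NA NB; lra.
  rewrite [leLHS](_ : _ = A ^+ 2 * (2 * (S ^+ 2 * B ^+ 2) + S ^+ 2 * (A * B))); last by ring.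
  rewrite [leRHS](_ : _ = A ^+ 2 * (2 * N + N)); last by ring.
  by apply: ler_wpM2l; [exact: sqr_ge0 | rewrite lerD// ler_wpM2l].
apply: le_trans key _.
have -> : 3 * (sin (pi * s) ^+ 2)^-1 * (2 `^ s) ^+ 2 / b ^+ 3 *
     (r `^ (2 * s - 2) * sigma `^ (2 * s - 1))
  = 3 * (sin (pi * s) ^+ 2)^-1 * ((2 `^ s) ^+ 2 / b ^+ 3 *
     (r `^ (2 * s - 2) * sigma `^ (2 * s - 1))) by ring.
apply: ler_wpM2l; first by rewrite mulr_ge0 ?invr_ge0 ?sqr_ge0.
apply: (le_trans (kern_numX_div_le 2 3 r0 g0)); apply: ler_wpM2l.
  by rewrite divr_ge0 ?exprn_ge0 ?powR_ge0// ltW.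
rewrite (_ : 2 * s * 2%:R - 3%:R = (2 * s - 2) + (2 * s - 1)); last by ring.
have h1 : 2 * s - 2 <= 0 by move: s12; lra.
have h2 : 2 * s - 1 <= 0 by move: s12; lra.
exact: powR_le_add.
Qed.

End KernelBounds.

(** * The inner integral *)

Lemma measurable_kern_num s :
  measurable_fun [set: measurableTypeR R * measurableTypeR R]
    (fun v => kern_num s v.1 v.2).
Proof.
apply: measurable_funM.
  by apply: (measurableT_comp (measurable_powR s)); exact: measurable_snd.
apply: (measurableT_comp (measurable_powR s)); apply: measurable_funD.
  exact: measurable_snd.
by apply: measurable_funM => //; exact: measurable_fst.
Qed.

(** The denominator being a square, its inverse is its real power of
    exponent -1, and real powers are measurable. *)
Lemma measurable_kern_full b s (e : bool) :
  measurable_fun [set: measurableTypeR R * measurableTypeR R]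
    (fun v => kern_full b s e v.1 v.2).
Proof.
have mK := measurable_kern_num s.
rewrite /kern_full; under eq_fun do rewrite -powR_inv1 ?sqr_ge0// normc_IdenomE.
apply: measurable_funM => //; apply: (measurableT_comp (measurable_powR _)).
apply: measurable_funD; apply: measurable_funX.
  apply: measurable_funB; first exact: measurable_funM.
  do 2 apply: measurable_funM => //.
  by apply: measurable_funD; [exact: measurable_snd | exact: measurable_fst].
exact: measurable_funM.
Qed.

Lemma measurable_kern_main b s :
  measurable_fun [set: measurableTypeR R * measurableTypeR R]
    (fun v => kern_main b s v.1 v.2).
Proof.
have mK := measurable_kern_num s.
rewrite /kern_main; under eq_fun do rewrite -powR_inv1 ?sqr_ge0//.
apply: measurable_funM => //; apply: (measurableT_comp (measurable_powR _)).
apply: measurable_funX; apply: measurable_funM => //.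
by apply: measurable_funD; [exact: measurable_snd | exact: measurable_fst].
Qed.

Definition laplace (k : R -> R -> R) a r :=
  \int[mu]_(sigma in pos) (expR (- (a * sigma)) * k r sigma).

(** By Tonelli's theorem, the integral of a nonnegative jointly measurable
    function depends measurably on the remaining variable. *)
Lemma measurable_laplace (k : R -> R -> R) a :
  (forall r sigma, 0 <= k r sigma) ->
  measurable_fun [set: measurableTypeR R * measurableTypeR R]
    (fun v => k v.1 v.2) ->
  measurable_fun [set: R] (laplace k a).
Proof.
move=> k0 mk.
pose g (v : measurableTypeR R * measurableTypeR R) :=
  (expR (- (a * v.2)) * k v.1 v.2 * \1_pos v.2)%:E.
have mg : measurable_fun [set: measurableTypeR R * measurableTypeR R] g.
  apply/measurable_EFinP/measurable_funM.
    apply: measurable_funM => //.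
    apply: (measurableT_comp (@measurable_expR R)).
    by apply: measurableT_comp => //; apply: measurable_funM.
  by apply: measurableT_comp; [exact: measurable_indic | exact: measurable_snd].
have g0 v : (0 <= g v)%E by rewrite lee_fin !mulr_ge0 ?expR_ge0// indicE ler0n.
have mF := @measurable_fun_fubini_tonelli_F _ _ _ _ R mu g mg g0.
have -> : laplace k a = fine \o fubini_F mu g.
  apply/funext => r; rewrite /laplace /Rintegral/= /fubini_F [in LHS]integral_mkcond.
  congr fine; apply: eq_integral => x _; rewrite /g/= patchE indicE.
  by case: ifP => _; rewrite ?mulr1 ?mulr0.
exact: measurableT_comp.
Qed.

Section LaplaceBound.
Variables (k : R -> R -> R) (C p q a r : R).
Hypotheses (q0 : 0 < q) (a0 : 0 < a) (r0 : 0 < r).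
Hypothesis mk : measurable_fun [set: R] (k r).
Hypothesis k_le : forall sigma, 0 < sigma ->
  `|k r sigma| <= C * (r `^ p * sigma `^ (q - 1)).

Let bound sigma := C * r `^ p * (sigma `^ (q - 1) * expR (- (a * sigma))).

Let le_bound sigma : pos sigma ->
  `|expR (- (a * sigma)) * k r sigma| <= bound sigma.
Proof.
rewrite /= in_itv/= andbT => g0; rewrite normrM ger0_norm ?expR_ge0// /bound.
rewrite [leRHS](_ : _ = expR (- (a * sigma))
  * (C * (r `^ p * sigma `^ (q - 1)))); last by ring.
by rewrite ler_wpM2l ?expR_ge0// k_le.
Qed.

Let integrable_bound : mu.-integrable pos (EFin \o bound).
Proof.
have := integrableZl measurable_pos (C * r `^ p) (integrable_gamma q0 a0).
by apply: eq_integrable.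
Qed.

Lemma integrable_laplace :
  mu.-integrable pos (EFin \o (fun sigma => expR (- (a * sigma)) * k r sigma)).
Proof.
apply: le_integrable integrable_bound => //.
  apply/measurable_EFinP; apply: measurable_funTS; apply: measurable_funM => //.
  by apply: measurableT_comp => //; apply: measurableT_comp => //.
by move=> x px; rewrite /= lee_fin (le_trans (le_bound px))// ler_norm.
Qed.

Lemma laplace_le : `|laplace k a r| <= C * r `^ p * (Gamma q / a `^ q).
Proof.
apply: (le_trans (le_normr_Rintegral _ integrable_laplace)) => //.
rewrite -Rintegral_gamma// -RintegralZl//; last exact: integrable_gamma.
apply: le_Rintegral => //.
exact: (@integrable_norm _ _ _ mu pos _ integrable_laplace).
Qed.

End LaplaceBound.

(** * The outer integral *)

(** A Hankel transform of the weight w at z, normalized by the factor (z/2)^nu of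
    the Bessel function so that it makes sense and is smooth at z = 0. *)
Definition hankel nu p w z :=
  \int[mu]_(r in pos) (r `^ p * clifford nu ((r * z / 2) ^+ 2) * w r).

Section Hankel.
Variables (w : R -> R) (C q a : R).
Hypothesis a0 : 0 < a.
Hypothesis mw : measurable_fun pos w.
Hypothesis w_le : forall r, 0 < r -> `|w r| <= C * (r `^ (q - 1) * expR (- (a * r))).

Let bound nu p r :=
  (Gamma (nu + 1))^-1 * C * (r `^ (p + q - 1) * expR (- (a * r))).

Let integrable_bound nu p : 0 < p + q -> mu.-integrable pos (EFin \o bound nu p).
Proof.
move=> pq0.
have := integrableZl measurable_pos ((Gamma (nu + 1))^-1 * C) (integrable_gamma pq0 a0).
by apply: eq_integrable.
Qed.

Let le_bound nu p z r : 0 <= nu -> 0 < r ->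
  `|r `^ p * clifford nu ((r * z / 2) ^+ 2) * w r| <= bound nu p r.
Proof.
move=> nu0 r0; rewrite 2!normrM (ger0_norm (powR_ge0 _ _)) /bound.
rewrite (_ : p + q - 1 = p + (q - 1)); last by ring.
rewrite gt0_powRD//.
rewrite [leRHS](_ : _ = r `^ p * (Gamma (nu + 1))^-1
  * (C * (r `^ (q - 1) * expR (- (a * r))))); last by ring.
apply: ler_pM => //; last exact: w_le.
  by rewrite mulr_ge0 ?powR_ge0.
by apply: ler_wpM2l; [exact: powR_ge0 | apply: clifford_bounded; rewrite // sqr_ge0].
Qed.

Lemma continuous_clifford nu : 0 <= nu -> continuous (clifford nu).
Proof.
move=> nu0 u; apply: differentiable_continuous; apply/derivable1_diffP.
by have [] := is_derive_clifford u nu0.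
Qed.

Lemma measurable_clifford nu : 0 <= nu -> measurable_fun [set: R] (clifford nu).
Proof. by move=> nu0; apply: continuous_measurable_fun; exact: continuous_clifford. Qed.

Lemma integrable_hankel nu p z : 0 <= nu -> 0 < p + q ->
  mu.-integrable pos
    (EFin \o (fun r => r `^ p * clifford nu ((r * z / 2) ^+ 2) * w r)).
Proof.
move=> nu0 pq0.
apply: le_integrable (integrable_bound nu pq0) => //.
  apply/measurable_EFinP; apply: measurable_funM => //.
  apply: measurable_funTS; apply: measurable_funM; first exact: measurable_powR.
  apply: (measurableT_comp (measurable_clifford nu0)).
  by apply: measurable_funX; do 2 apply: measurable_funM => //.
move=> r; rewrite /= in_itv/= andbT => r0.
by rewrite lee_fin (le_trans (le_bound p z nu0 r0))// ler_norm.
Qed.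

Lemma hankel_le nu p z : 0 <= nu -> 0 < p + q ->
  `|hankel nu p w z| <= (Gamma (nu + 1))^-1 * C * (Gamma (p + q) / a `^ (p + q)).
Proof.
move=> nu0 pq0.
apply: (le_trans (le_normr_Rintegral _ (integrable_hankel z nu0 pq0))) => //.
rewrite -Rintegral_gamma// -RintegralZl//; last exact: integrable_gamma.
apply: le_Rintegral => //.
- exact: (@integrable_norm _ _ _ mu pos _ (integrable_hankel z nu0 pq0)).
- exact: integrable_bound.
- by move=> r; rewrite /= in_itv/= andbT => r0; exact: le_bound.
Qed.

(** Near z the derivative of the integrand is at most (|z| + 1)/2 times the
    integrable majorant attached to the parameters nu + 1 and p + 2. *)
Lemma is_derive_hankel nu p z : 0 <= nu -> 0 < p + q ->
  is_derive z 1 (hankel nu p w) (- (z / 2) * hankel (nu + 1) (p + 2) w z).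
Proof.
move=> nu0 pq0; have nu1 : 0 <= nu + 1 by rewrite addr_ge0.
have pq2 : 0 < p + 2 + q by rewrite addrAC addr_gt0.
have C0 : 0 <= C.
  have := le_trans (normr_ge0 _) (w_le ltr01).
  by rewrite pmulr_lge0// mulr_gt0 ?powR_gt0 ?expR_gt0.
pose f x r := r `^ p * clifford nu ((r * x / 2) ^+ 2) * w r.
have df x r : 0 < r -> is_derive x 1 (f ^~ r)
   (- (x / 2) * (r `^ (p + 2) * clifford (nu + 1) ((r * x / 2) ^+ 2) * w r)).
  move=> r0.
  have d1 : is_derive x 1 (fun x => (r * x / 2) ^+ 2) (r ^+ 2 * x / 2).
    by apply: is_derive_eq; rewrite /GRing.scale/=; field.
  have d2 : is_derive x 1 (clifford nu \o (fun x => (r * x / 2) ^+ 2))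
      (- clifford (nu + 1) ((r * x / 2) ^+ 2) * (r ^+ 2 * x / 2)).
    by apply: is_derive1_comp => //; exact: is_derive_clifford.
  have cd (h : R -> R) dh c d : is_derive x 1 h dh ->
      is_derive x 1 (fun x => c * h x * d) (c * dh * d).
    by move=> dh_; apply: is_derive_eq; rewrite /GRing.scale/=; ring.
  have := cd _ _ (r `^ p) (w r) d2; congr is_derive.
  rewrite gt0_powRD// -[2]/(2%:R) powR_mulrn ?(ltW r0)//.
  by move: (clifford _ _) => c; ring.
pose M := (`|z| + 1) / 2.
pose G r := M * bound (nu + 1) (p + 2) r.
have M0 : 0 <= M by rewrite divr_ge0 ?addr_ge0.
have Iz : `](z - 1), (z + 1)[%classic z by rewrite /= in_itv/= ltrBlDr ltrDl ltr01.
have intf x : `](z - 1), (z + 1)[%classic x -> mu.-integrable pos (EFin \o f x).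
  by move=> _; exact: integrable_hankel.
have df1 x r : `](z - 1), (z + 1)[%classic x -> pos r -> derivable (f ^~ r) x 1.
  by move=> _; rewrite /= in_itv/= andbT => r0; have [] := df x r r0.
have G0 r : 0 <= G r.
  rewrite /G /bound !mulr_ge0 ?powR_ge0 ?expR_ge0//.
  by rewrite invr_ge0 ltW// Gamma_gt0// lerDr.
have intG : mu.-integrable pos (EFin \o G).
  have := integrableZl measurable_pos M (integrable_bound (nu + 1) pq2).
  by apply: eq_integrable.
have Gub x r : `](z - 1), (z + 1)[%classic x -> pos r -> `|partial1of2 f x r| <= G r.
  rewrite /= !in_itv/= andbT => /andP[x1 x2] r0.
  rewrite partial1of2E; have [_ ->] := df x r r0.
  rewrite normrM; apply: ler_pM => //; last exact: le_bound.
  rewrite normrN normf_div (ger0_norm (ler0n _ _)) ler_wpM2r ?invr_ge0//.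
  rewrite -[x](subrK z) addrC (le_trans (ler_normD _ _))// lerD2l.
  by rewrite ler_norml; apply/andP; split; lra.
apply: DeriveDef.
  exact: (@derivable_under_integral _ _ _ mu f pos measurable_pos z _ _ Iz
    intf df1 G G0 intG Gub).
rewrite -derive1E (@differentiation_under_integral _ _ _ mu f pos measurable_pos
  z _ _ Iz intf df1 G G0 intG Gub).
rewrite -RintegralZl//; last exact: integrable_hankel.
apply: eq_Rintegral => r; rewrite inE/= in_itv/= andbT => r0.
by rewrite partial1of2E; have [_ ->] := df z r r0.
Qed.

End Hankel.

(** * Smooth functions closed under differentiation *)

Lemma is_derive_cvg_quotient f x l (A : set R) : is_derive x 1 f l ->
  (f y - f x) / (y - x) @[y --> within A x^'] --> l.
Proof.
move=> df.
have : h^-1 *: (f (h + x) - f x) @[h --> 0^'] --> l.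
  have [/cvg_ex[l' fl'] ll] := df.
  have : h^-1 *: ((f \o shift x) (h *: (1 : R)) - f x) @[h --> 0^'] --> l.
    by move/cvg_lim: (fl') ll; rewrite /derive => ->// <-.
  by apply: cvg_trans; apply: near_eq_cvg; apply: nearW => h /=; rewrite /GRing.scale/= mulr1.
move=> /cvgrPdist_le fl; apply/cvgrPdist_le => eps eps0.
have [d /= d0 hd] := fl eps eps0.
exists d => //= y /= xy yx _.
have := hd (y - x); rewrite /= sub0r normrN distrC => /(_ xy).
rewrite subr_eq0 => /(_ yx); rewrite subrK.
by rewrite /GRing.scale/= mulrC.
Qed.

(** The successive derivatives are obtained by iterating a choice of derivative
    within P. *)
Lemma smooth_halfline_closed (P : (R -> R) -> Prop) f :
  (forall g, P g -> exists2 g', P g' & forall x, is_derive x 1 g (g' x)) ->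
  P f -> smooth_halfline f.
Proof.
move=> Pd Pf.
have /choice[next nextP] : forall g, exists g',
    P g -> P g' /\ forall x, is_derive x 1 g (g' x).
  move=> g; have [/Pd[g' Pg' dg]|nPg] := pselect (P g); first by exists g'.
  by exists g.
exists (fun k => iter k next f); split=> // k x _ /=.
have Pk : P (iter k next f) by elim: k => //= k /nextP[].
by apply: is_derive_cvg_quotient; have [_] := nextP _ Pk.
Qed.

Section SmoothFamily.
Variable H : nat -> R -> R.
Hypothesis dH : forall j x, is_derive x 1 (H j) (- (x / 2) * H j.+1 x).

(** Closed under differentiation because (H j)' = - (x/2) H (j + 1) and
    because monomials and powers of 1 + x^2 reproduce themselves. *)
Inductive hankel_span : (R -> R) -> Prop :=
| hankel_span_term c m p j :
    hankel_span (fun x => c * x ^+ m * (1 + x ^+ 2) `^ p * H j x)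
| hankel_span_add f g : hankel_span f -> hankel_span g ->
    hankel_span (fun x => f x + g x).

Lemma hankel_span_derive g : hankel_span g ->
  exists2 g', hankel_span g' & forall x, is_derive x 1 g (g' x).
Proof.
elim=> [c m p j|f1 f2 _ [g1 Hg1 d1] _ [g2 Hg2 d2]]; last first.
  by exists (fun x => g1 x + g2 x); [exact: hankel_span_add | move=> x; exact: is_deriveD].
exists (fun x => (c * m%:R) * x ^+ m.-1 * (1 + x ^+ 2) `^ p * H j x
  + ((2 * p * c) * x ^+ m.+1 * (1 + x ^+ 2) `^ (p - 1) * H j x
  + (- (c / 2)) * x ^+ m.+1 * (1 + x ^+ 2) `^ p * H j.+1 x)).
  apply: hankel_span_add; first exact: hankel_span_term.
  by apply: hankel_span_add; exact: hankel_span_term.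
move=> x.
have x21 : 0 < 1 + x ^+ 2 by rewrite ltr_pwDl// sqr_ge0.
have d1 : is_derive x 1 (fun x => 1 + x ^+ 2) (2 * x).
  by apply: is_derive_eq; rewrite /GRing.scale/=; ring.
have d2 : is_derive x 1 (@powR R ^~ p \o (fun x => 1 + x ^+ 2))
    (p * (1 + x ^+ 2) `^ (p - 1) * (2 * x)).
  by apply: is_derive1_comp => //; exact: is_derive1_powR.
have dX : is_derive x 1 (fun x => x ^+ m) (m%:R * x ^+ m.-1).
  have := is_deriveX m (is_derive_id x 1); rewrite exprfctE.
  by rewrite /GRing.scale/= mulr1.
have dprod (h u v : R -> R) dh du dv :
    is_derive x 1 h dh -> is_derive x 1 u du -> is_derive x 1 v dv ->
    is_derive x 1 (fun x => c * h x * u x * v x)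
    (c * dh * u x * v x + c * h x * du * v x + c * h x * u x * dv).
  by move=> hh hu hv; apply: is_derive_eq; rewrite /GRing.scale/=; ring.
have := dprod _ _ _ _ _ _ dX d2 (dH j x); congr is_derive.
rewrite /= (exprS x m).
move: (_ `^ p) (_ `^ (p - 1)) (H j x) (H j.+1 x) => A B h0 h1.
by field.
Qed.

Lemma smooth_hankel_span c p j :
  smooth_halfline (fun x => c * ((1 + x ^+ 2) `^ p * H j x)).
Proof.
apply: (@smooth_halfline_closed hankel_span); first exact: hankel_span_derive.
rewrite (_ : (fun x => _) = (fun x => c * x ^+ 0 * (1 + x ^+ 2) `^ p * H j x)).
  exact: hankel_span_term.
by apply/funext => x; rewrite expr0; ring.
Qed.

End SmoothFamily.

(** * Homogeneity, error estimate and the limit at the origin *)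

(** The function of r against which the Bessel function is integrated, up to the
    power of r. *)
Definition weight (k : R -> R -> R) a r := expR (- (a * r)) * laplace k a r.

Lemma weight_le (k : R -> R -> R) C p q a : 0 < q -> 0 < a ->
  (forall r, measurable_fun [set: R] (k r)) ->
  (forall r sigma, 0 < r -> 0 < sigma ->
    `|k r sigma| <= C * (r `^ p * sigma `^ (q - 1))) ->
  forall r, 0 < r -> `|weight k a r|
    <= C * (Gamma q / a `^ q) * (r `^ p * expR (- (a * r))).
Proof.
move=> q0 a0 mk k_le r r0; rewrite normrM ger0_norm ?expR_ge0//.
rewrite [leRHS](_ : _ = expR (- (a * r)) * (C * r `^ p * (Gamma q / a `^ q))); last by ring.
rewrite ler_wpM2l ?expR_ge0//; apply: laplace_le => //.
by move=> sigma g0; exact: k_le.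
Qed.

Lemma measurable_weight (k : R -> R -> R) a :
  (forall r sigma, 0 <= k r sigma) ->
  measurable_fun [set: measurableTypeR R * measurableTypeR R]
    (fun v => k v.1 v.2) ->
  measurable_fun pos (weight k a).
Proof.
move=> k0 mk; apply: measurable_funTS; apply: measurable_funM; last first.
  exact: measurable_laplace.
apply: measurableT_comp; first exact: measurable_expR.
by apply: measurableT_comp => //; exact: measurable_funM.
Qed.

Lemma measurable_section (k : R -> R -> R) r :
  measurable_fun [set: measurableTypeR R * measurableTypeR R]
    (fun v => k v.1 v.2) ->
  measurable_fun [set: R] (k r).
Proof.
move=> mk.
exact: (measurableT_comp mk (@measurable_pair1 _ _ (measurableTypeR R) (measurableTypeR R) r)).
Qed.

Section Kernel.
Variables (b s : R) (e : bool).
Hypotheses (b0 : 0 < b) (s0 : 0 < s) (s12 : s < 1 / 2).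

Local Notation C1 := ((sin (pi * s) ^+ 2)^-1 * (2 `^ s / b ^+ 2)).

Lemma kern_full_ge0 r sigma : 0 <= kern_full b s e r sigma.
Proof. by rewrite divr_ge0 ?kern_num_ge0 ?sqr_ge0. Qed.

Lemma kern_main_ge0 r sigma : 0 <= kern_main b s r sigma.
Proof. by rewrite divr_ge0 ?kern_num_ge0 ?sqr_ge0. Qed.

(** The source of the power |x_n|^-(n-2+2s) of the main term. *)
Lemma kern_main_homo c r sigma : 0 < c -> 0 < r -> 0 < sigma ->
  kern_main b s (c * r) (c * sigma) = c `^ (2 * s - 2) * kern_main b s r sigma.
Proof.
move=> c0 r0 g0; rewrite /kern_main /kern_num.
rewrite (_ : c * sigma + 2 * (c * r) = c * (sigma + 2 * r)); last by ring.
rewrite -mulrDr !powRM ?ltW//; last by rewrite addr_gt0// mulr_gt0.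
rewrite gt0_powRD// powRN powR_mulrn ?(ltW c0)//.
rewrite (_ : 2 * s = s + s); last by ring.
rewrite gt0_powRD//; field.
by rewrite !gt_eqF ?addr_gt0.
Qed.

Let k_full_le r sigma : 0 < r -> 0 < sigma ->
  `|kern_full b s e r sigma| <= C1 * (r `^ (s - 1) * sigma `^ (s - 1)).
Proof. by move=> r0 g0; rewrite ger0_norm ?kern_full_ge0// kern_full_le. Qed.

Let k_main_le r sigma : 0 < r -> 0 < sigma ->
  `|kern_main b s r sigma|
    <= 2 `^ s / b ^+ 2 * (r `^ (s - 1) * sigma `^ (s - 1)).
Proof. by move=> r0 g0; rewrite ger0_norm ?kern_main_ge0// kern_main_le. Qed.

Let mk_full := measurable_kern_full b s e.
Let mk_main := measurable_kern_main b s.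

Lemma integrable_laplace_full a r : 0 < a -> 0 < r -> mu.-integrable pos
  (EFin \o (fun sigma => expR (- (a * sigma)) * kern_full b s e r sigma)).
Proof.
move=> a0 r0; apply: (@integrable_laplace (kern_full b s e) C1 (s - 1) s) => //.
  exact: measurable_section.
by move=> sigma g0; exact: k_full_le.
Qed.

Lemma integrable_laplace_main a r : 0 < a -> 0 < r -> mu.-integrable pos
  (EFin \o (fun sigma => expR (- (a * sigma)) * kern_main b s r sigma)).
Proof.
move=> a0 r0.
apply: (@integrable_laplace (kern_main b s) (2 `^ s / b ^+ 2) (s - 1) s) => //.
  exact: measurable_section.
by move=> sigma g0; exact: k_main_le.
Qed.

Lemma IintE (xn r : R) : 0 < r -> xn != 0 ->
  Iint b s e r xn = 4 * pi * sin (pi * s) * laplace (kern_full b s e) `|xn| r.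
Proof.
move=> r0 xn0; have a0 : 0 < `|xn| by rewrite normr_gt0.
rewrite /Iint /laplace -[RHS]mulrA; congr (_ * _).
rewrite -RintegralZl//; last first.
  exact: integrable_laplace_full.
by apply: eq_Rintegral => sigma _; rewrite /kern_full /kern_num mulNr; ring.
Qed.

Lemma weight_diffE a r : 0 < a -> 0 < r ->
  weight (kern_full b s e) a r - weight (kern_main b s) a r
  = weight (fun r sigma => kern_full b s e r sigma - kern_main b s r sigma) a r.
Proof.
move=> a0 r0; rewrite /weight -mulrBr; congr (_ * _).
rewrite /laplace -RintegralB//.
- by apply: eq_Rintegral => sigma _; rewrite mulrBr.
- exact: integrable_laplace_full.
- exact: integrable_laplace_main.
Qed.

(** Degree 2s - 2 of the kernel, plus 1 from the change of variable in the inner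
    integral. *)
Lemma weight_main_homo a r : 0 < a -> 0 < r ->
  weight (kern_main b s) 1 (a * r)
  = a `^ (2 * s - 1) * weight (kern_main b s) a r.
Proof.
move=> a0 r0; rewrite /weight mul1r mulrCA; congr (_ * _).
have ar0 : 0 < a * r by rewrite mulr_gt0.
rewrite {1}/laplace (Rintegral_dilation a0); last first.
  exact: integrable_laplace_main.
rewrite (_ : 2 * s - 1 = 1 + (2 * s - 2)); last by ring.
rewrite gt0_powRD// powRr1 ?(ltW a0)// -mulrA; congr (_ * _).
rewrite -RintegralZl//; last first.
  exact: integrable_laplace_main.
apply: eq_Rintegral => sigma; rewrite inE/= in_itv/= andbT => g0.
by rewrite mul1r kern_main_homo// mulrCA.
Qed.

End Kernel.

Section Transform.
Variables (b s nu : R) (e : bool).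
Hypotheses (b0 : 0 < b) (s0 : 0 < s) (s12 : s < 1 / 2) (nu0 : 0 <= nu).

Let mk_full := measurable_kern_full b s e.
Let mk_main := measurable_kern_main b s.

Local Notation C1 := ((sin (pi * s) ^+ 2)^-1 * (2 `^ s / b ^+ 2)).
Local Notation C2 := (3 * (sin (pi * s) ^+ 2)^-1 * (2 `^ s) ^+ 2 / b ^+ 3).

Lemma weight_full_le a r : 0 < a -> 0 < r ->
  `|weight (kern_full b s e) a r|
  <= C1 * (Gamma s / a `^ s) * (r `^ (s - 1) * expR (- (a * r))).
Proof.
move=> a0 r0; apply: weight_le => //; first by move=> ?; exact: measurable_section.
by move=> ? ? ? ?; rewrite ger0_norm ?kern_full_ge0// kern_full_le.
Qed.

Lemma weight_main_le a r : 0 < a -> 0 < r ->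
  `|weight (kern_main b s) a r|
  <= 2 `^ s / b ^+ 2 * (Gamma s / a `^ s) * (r `^ (s - 1) * expR (- (a * r))).
Proof.
move=> a0 r0; apply: weight_le => //; first by move=> ?; exact: measurable_section.
by move=> ? ? ? ?; rewrite ger0_norm ?kern_main_ge0// kern_main_le.
Qed.

Lemma weight_diff_le a r : 0 < a -> 0 < r ->
  `|weight (kern_full b s e) a r - weight (kern_main b s) a r|
  <= C2 * (Gamma (2 * s) / a `^ (2 * s))
     * (r `^ (2 * s - 1 - 1) * expR (- (a * r))).
Proof.
move=> a0 r0; rewrite weight_diffE//.
rewrite (_ : 2 * s - 1 - 1 = 2 * s - 2); last by ring.
apply: weight_le => //; first by rewrite mulr_gt0.
- move=> ?; apply: measurable_funB; first exact: (@measurable_section (kern_full b s e)).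
  exact: (@measurable_section (kern_main b s)).
- by move=> ? ? ? ?; exact: kern_diff_le.
Qed.

Let mw_full a : measurable_fun pos (weight (kern_full b s e) a).
Proof. by apply: measurable_weight => //; exact: kern_full_ge0. Qed.

Let mw_main a : measurable_fun pos (weight (kern_main b s) a).
Proof. by apply: measurable_weight => //; exact: kern_main_ge0. Qed.

Local Notation pw := (2 * nu + 1).

Let ps : 0 < pw + s.
Proof. by rewrite addr_gt0// ltr_wpDl// mulr_ge0. Qed.

(** The inner integral contributes Gamma(2s) a^-(2s), the outer one
    Gamma(2 nu + 2s) a^-(2 nu + 2s); the constant is uniform in z because the
    normalized Bessel function is bounded on the whole half-line. *)
Lemma hankel_diff_le : exists C, forall a z, 0 < a ->
  `|hankel nu pw (weight (kern_full b s e) a) z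
    - hankel nu pw (weight (kern_main b s) a) z|
  <= C / a `^ (2 * nu + 4 * s).
Proof.
exists ((Gamma (nu + 1))^-1 * (C2 * Gamma (2 * s) * Gamma (2 * nu + 2 * s))).
move=> a z a0.
have i1 := integrable_hankel a0 (mw_full a)
  (fun r => @weight_full_le a r a0) z nu0 ps.
have i2 := integrable_hankel a0 (mw_main a)
  (fun r => @weight_main_le a r a0) z nu0 ps.
rewrite /hankel -RintegralB//.
under eq_Rintegral do rewrite -mulrBr.
have pq : 0 < pw + (2 * s - 1).
  by rewrite (_ : _ + _ = 2 * (nu + s)); [rewrite mulr_gt0// ltr_wpDl | ring].
have mw : measurable_fun pos
    (fun r => weight (kern_full b s e) a r - weight (kern_main b s) a r).
  exact: measurable_funB.
have := hankel_le a0 mw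
  (fun r => @weight_diff_le a r a0) z nu0 pq.
rewrite /hankel => /le_trans; apply; rewrite le_eqVlt; apply/orP; left; apply/eqP.
rewrite (_ : pw + (2 * s - 1) = 2 * nu + 2 * s); last by ring.
rewrite (_ : 2 * nu + 4 * s = 2 * s + (2 * nu + 2 * s)); last by ring.
rewrite (gt0_powRD (2 * s))// (invfM (a `^ (2 * s))).
by move: (Gamma _) (Gamma _) (Gamma _) (C2) => g1 g2 g3 c; ring.
Qed.

(** The substitution r = t/a, combined with the homogeneity of the weight. *)
Lemma hankel_main_homo a z : 0 < a ->
  hankel nu pw (weight (kern_main b s) a) z
  = hankel nu pw (weight (kern_main b s) 1) (z / a) / a `^ (pw + 2 * s).
Proof.
move=> a0.
have int1 := integrable_hankel ltr01 (mw_main 1)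
  (fun r => @weight_main_le 1 r ltr01) (z / a) nu0 ps.
have inta := integrable_hankel a0 (mw_main a)
  (fun r => @weight_main_le a r a0) z nu0 ps.
have apE : a `^ (pw + 2 * s) = a * (a `^ pw * a `^ (2 * s - 1)).
  rewrite (_ : pw + 2 * s = 1 + (pw + (2 * s - 1))); last by ring.
  by rewrite !(gt0_powRD _ _ a0) (powRr1 (ltW a0)).
suff E : hankel nu pw (weight (kern_main b s) 1) (z / a)
    = a `^ (pw + 2 * s) * hankel nu pw (weight (kern_main b s) a) z.
  by rewrite E [RHS]mulrC mulKf// gt_eqF// powR_gt0.
rewrite [LHS](Rintegral_dilation a0 int1) apE -[RHS]mulrA; congr (a * _).
rewrite -[RHS](RintegralZl _ measurable_pos inta).
apply: eq_Rintegral => r; rewrite inE/= in_itv/= andbT => r0.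
rewrite weight_main_homo// (powRM _ (ltW a0) (ltW r0)).
rewrite (_ : a * r * (z / a) / 2 = r * z / 2); last by field; rewrite gt_eqF.
by move: (clifford _ _) (weight _ _ _) => c w; ring.
Qed.

Lemma continuous_hankel_full a : 0 < a ->
  continuous (hankel nu pw (weight (kern_full b s e) a)).
Proof.
move=> a0 z; apply: differentiable_continuous; apply/derivable1_diffP.
by have [] := is_derive_hankel a0 (mw_full a)
  (fun r => @weight_full_le a r a0) z nu0 ps.
Qed.

Lemma smooth_hankel_main c q :
  smooth_halfline (fun z => c * ((1 + z ^+ 2) `^ q
    * hankel nu pw (weight (kern_main b s) 1) z)).
Proof.
pose H j z := hankel (nu + j%:R) (pw + 2 * j%:R) (weight (kern_main b s) 1) z.
have dH j z : is_derive z 1 (H j) (- (z / 2) * H j.+1 z).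
  have nuj : 0 <= nu + j%:R by rewrite addr_ge0.
  have pj : 0 < pw + 2 * j%:R + s by rewrite addrAC ltr_wpDr// mulr_ge0.
  rewrite /H (_ : nu + j.+1%:R = nu + j%:R + 1); last by rewrite -natr1; ring.
  rewrite (_ : pw + 2 * j.+1%:R = pw + 2 * j%:R + 2); last by rewrite -natr1; ring.
  exact: (is_derive_hankel ltr01 (mw_main 1)
    (fun r => @weight_main_le 1 r ltr01) z nuj pj).
have := smooth_hankel_span dH c q 0; rewrite /H.
by rewrite addr0 mulr0 addr0.
Qed.

(** The powers of r combine into 2 nu + 1 = n - 2, and the power of rho from the
    Bessel function cancels the prefactor rho^-nu. *)
Lemma bessel_integralE (xn rho : R) : xn != 0 -> 0 < rho ->
  1 / rho `^ nu * \int[mu]_(r in pos)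
    (besselJ nu (r * rho) * r `^ (nu + 1) * expR (- (r * `|xn|))
      * Iint b s e r xn)
  = 2 `^ (- nu) * (4 * pi * sin (pi * s))
    * hankel nu pw (weight (kern_full b s e) `|xn|) rho.
Proof.
move=> xn0 rho0; have a0 : 0 < `|xn| by rewrite normr_gt0.
have i1 := integrable_hankel a0 (mw_full `|xn|)
  (fun r => @weight_full_le `|xn| r a0) rho nu0 ps.
set K := 2 `^ (- nu) * _.
have rn0 : rho `^ nu != 0 by rewrite gt_eqF// powR_gt0.
suff -> : \int[mu]_(r in pos)
    (besselJ nu (r * rho) * r `^ (nu + 1) * expR (- (r * `|xn|))
      * Iint b s e r xn)
    = rho `^ nu * K * hankel nu pw (weight (kern_full b s e) `|xn|) rho.
  by rewrite div1r -mulrA mulKf.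
rewrite -[RHS](RintegralZl _ measurable_pos i1).
apply: eq_Rintegral => r; rewrite inE/= in_itv/= andbT => r0.
have rrho0 : 0 < r * rho by rewrite mulr_gt0.
rewrite (besselJE nu0 rrho0) (IintE _ b0 s0 s12 r0 xn0) /weight.
rewrite (powRM _ (ltW rrho0)) ?invr_ge0// (powRM _ (ltW r0) (ltW rho0)).
have -> : 2^-1 `^ nu = 2 `^ (- nu) :> R by rewrite -powR_inv1// -powRrM mulN1r.
have -> : r `^ pw = r `^ nu * r `^ (nu + 1).
  by rewrite -(gt0_powRD _ _ r0); congr (_ `^ _); ring.
rewrite /K [r * `|xn|]mulrC.
move: (clifford _ _) (laplace _ _ _) (expR _) => c l x.
by ring.
Qed.

End Transform.

End HalfLine.

Lemma enorm0 (R : realType) m : enorm (0 : 'rV[R]_m) = 0.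
Proof.
by rewrite /enorm big1 ?sqrtr0// => i _; rewrite mxE expr0n.
Qed.

Lemma enorm_gt0 (R : realType) m (y : 'rV[R]_m) : y != 0 -> 0 < enorm y.
Proof.
move=> y0; rewrite /enorm sqrtr_gt0 lt_neqAle sumr_ge0 ?andbT; last first.
  by move=> i _; exact: sqr_ge0.
apply: contra y0; rewrite eq_sym psumr_eq0; last by move=> i _; exact: sqr_ge0.
move=> /allP y0; apply/eqP/rowP => i; rewrite mxE; apply/eqP.
by have := y0 i; rewrite mem_index_enum sqrf_eq0 => /(_ isT).
Qed.

Lemma enorm_cvg0 (R : realType) m :
  enorm y @[y --> (0 : 'rV[R]_m)] --> (0 : R).
Proof.
rewrite -[X in _ --> X](@enorm0 R m) /enorm.
apply: continuous_comp; last exact: sqrt_continuous.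
apply: continuous_big => [|i _ y]; first exact: add_continuous.
apply: (@continuous_comp _ _ _ (fun x : 'rV[R]_m => x ord0 i) (fun t => t ^+ 2)).
  exact: coord_continuous.
exact: exprn_continuous.
Qed.

(** Dimension at least 1 is what prevents 0 from being isolated: the line spanned
    by a nonzero vector accumulates at 0. *)
Lemma rV_dnbhs0_proper (R : realType) m : ProperFilter ((0 : 'rV[R]_m.+1)^').
Proof.
apply: Build_ProperFilter_ex => P nP; pose v : 'rV[R]_m.+1 := const_mx 1.
have v0 : v != 0.
  by apply/eqP => /rowP/(_ ord0); rewrite !mxE => /eqP; rewrite oner_eq0.
have tv0 : t *: v @[t --> (0 : R)] --> (0 : 'rV[R]_m.+1).
  by rewrite -[X in _ --> X](scale0r v); exact: scalel_continuous.
have {}nP : \forall t \near (0 : R), t *: v != 0 -> P (t *: v).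
  exact: (tv0 _ nP).
have {}nP : \forall t \near (0 : R)^', P (t *: v).
  suff : \forall t \near (0 : R), t != 0 -> P (t *: v) by [].
  by apply: filterS nP => t h t0; apply: h; rewrite scaler_eq0 negb_or t0.
by have [t Pt] := filter_ex nP; exists (t *: v).
Qed.

Lemma lim_punctured_enorm (R : realType) m (f : R -> R) (g : 'rV[R]_m.+1 -> R) :
  {for 0, continuous f} -> (forall y, y != 0 -> g y = f (enorm y)) ->
  lim (g y @[y --> (0 : 'rV[R]_m.+1)^']) = f 0.
Proof.
move=> cf gE; have PF := rV_dnbhs0_proper R m; apply: cvg_lim => //.
apply: (@cvg_trans _ (f (enorm y) @[y --> (0 : 'rV[R]_m.+1)^'])).
  apply: near_eq_cvg.
  suff : \forall y \near (0 : 'rV[R]_m.+1), y != 0 -> f (enorm y) = g y by [].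
  by apply: (@filterE _ _ (@nbhs_filter _ (0 : 'rV[R]_m.+1))) => y /gE.
apply: cvg_comp; last exact: cf.
apply: cvg_trans (@enorm_cvg0 R m.+1).
by apply: cvg_app; exact: cvg_within.
Qed.

Theorem proposition4p4 (R : realType) (n : nat) (b s : R)
    (hn : (3 <= n)%N) (hb : 0 < b) (hs0 : 0 < s) (hs : s < 1 / 2)
    (hirr : irrational s) :
  exists L : bool -> R -> R,
    (forall e : bool, smooth_halfline (L e)) /\
    (forall (e : bool) (M : R),
      exists C delta : R, 0 < delta /\
        forall (x' : 'rV[R]_n.-1) (xn : R),
          0 < (-1) ^+ e * xn ->
          `|xn| + enorm x' < delta ->
          enorm x' / `|xn| <= M ->
          `|lhs b s e x' xn
             - L e (enorm x' / `|xn|)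
                 / (xn ^+ 2 + enorm x' ^+ 2) `^ ((n%:R - 2 + 2 * s) / 2)|
            <= C * (1 / (`|xn| + enorm x') `^ (n%:R - 3 + 4 * s))).
Proof.
case: n hn => [//|[//|n]] hn; rewrite [n.+2.-1]/=.
set N : R := n.+2%:R.
have nu0 : 0 <= (N - 3) / 2 by rewrite divr_ge0// subr_ge0 ler_nat.
set nu := (N - 3) / 2 in nu0.
have NE : N = 2 * nu + 3 by rewrite /nu; field.
pose K : R := 2 `^ (- nu) * (4 * pi * sin (pi * s)).
have K0 : 0 <= K.
  by rewrite !mulr_ge0 ?powR_ge0 ?pi_ge0 ?(ltW (sin_pis_gt0 hs0 hs)).
(* The two branches of the definition of the left-hand side agree: at x' = 0 it
   is the limit, hence the value, of a function continuous in rho. *)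
have lhsE e (x' : 'rV[R]_n.+1) xn : xn != 0 -> lhs (n := n.+2) b s e x' xn
    = K * hankel nu (2 * nu + 1) (weight (kern_full b s e) `|xn|) (enorm x').
  move=> xn0.
  have offE y : y != 0 -> lhs_off (n := n.+2) b s e y xn
    = K * hankel nu (2 * nu + 1) (weight (kern_full b s e) `|xn|) (enorm y).
    move=> /enorm_gt0 y0; rewrite /lhs_off -/N -/nu.
    rewrite (_ : (N - 1) / 2 = nu + 1); last by rewrite NE; field.
    exact: bessel_integralE.
  rewrite /lhs; case: eqVneq => [->|x0]; last exact: offE.
  rewrite enorm0.
  apply: (@lim_punctured_enorm R n (fun z => K * hankel _ _ _ z)) => //.
  have a0 : 0 < `|xn| by rewrite normr_gt0.
  apply: cvgMr; exact: continuous_hankel_full.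
exists (fun _ z => K * ((1 + z ^+ 2) `^ ((N - 2 + 2 * s) / 2)
  * hankel nu (2 * nu + 1) (weight (kern_main b s) 1) z)).
split=> [_|e M]; first exact: smooth_hankel_main.
(* On the region rho/a <= M one has a + rho <= (1 + M) a, so powers of a and of
   a + rho are interchangeable up to a power of 1 + M. *)
have [C hC] := hankel_diff_le e hb hs0 hs nu0.
exists (K * C * (1 + M) `^ (N - 3 + 4 * s)), 1; split=> // x' xn xn_sgn _ hM.
have xn0 : xn != 0 by apply: contraTneq xn_sgn => ->; rewrite mulr0 ltxx.
have a0 : 0 < `|xn| by rewrite normr_gt0.
have rho0 : 0 <= enorm x' := sqrtr_ge0 _.
rewrite lhsE//; move: (enorm x') hM rho0 => rho hM rho0.
have a_ne0 : `|xn| != 0 by rewrite gt_eqF.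
(* x_n^2 + rho^2 = a^2 (1 + (rho/a)^2), and the exponent of a,
   n - 2 + 2s = 2 nu + 1 + 2s, is the degree of homogeneity. *)
have mainE : K * ((1 + (rho / `|xn|) ^+ 2) `^ ((N - 2 + 2 * s) / 2)
      * hankel nu (2 * nu + 1) (weight (kern_main b s) 1) (rho / `|xn|))
    / (xn ^+ 2 + rho ^+ 2) `^ ((N - 2 + 2 * s) / 2)
  = K * hankel nu (2 * nu + 1) (weight (kern_main b s) `|xn|) rho.
  rewrite (hankel_main_homo hb hs0 hs nu0 rho a0).
  have -> : xn ^+ 2 + rho ^+ 2 = `|xn| ^+ 2 * (1 + (rho / `|xn|) ^+ 2).
    by rewrite -[xn ^+ 2]real_normK ?num_real//; field.
  have u0 : 0 < 1 + (rho / `|xn|) ^+ 2 by rewrite ltr_pwDl// sqr_ge0.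
  rewrite powRM ?(ltW u0) ?sqr_ge0//.
  have -> : (`|xn| ^+ 2) `^ ((N - 2 + 2 * s) / 2) = `|xn| `^ (2 * nu + 1 + 2 * s).
    rewrite -powR_mulrn ?normr_ge0// -powRrM; congr (_ `^ _).
    by rewrite NE; field.
  have v0 := powR_gt0 ((N - 2 + 2 * s) / 2) u0.
  have w0 := powR_gt0 (2 * nu + 1 + 2 * s) a0.
  move: (hankel _ _ _ _) (_ `^ _) (_ `^ _) v0 w0 => h v w v0 w0; field.
  by rewrite !gt_eqF.
rewrite mainE -mulrBr normrM (ger0_norm K0) -(mulrA K C) -(mulrA K (C * _)).
apply: ler_wpM2l => //; rewrite -mulrA.
apply: (le_trans (hC _ _ a0)).
have C0 : 0 <= C.
  have := le_trans (normr_ge0 _) (hC 1 0 ltr01).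
  by rewrite powR1 divr1.
rewrite (_ : 2 * nu + 4 * s = N - 3 + 4 * s); last by rewrite NE; ring.
apply: ler_wpM2l => //; rewrite div1r.
have kap0 : 0 <= N - 3 + 4 * s by rewrite addr_ge0 ?mulr_ge0 ?(ltW hs0)// subr_ge0 ler_nat.
have M1 : 0 <= 1 + M.
  by rewrite addr_ge0// (le_trans _ hM)// divr_ge0.
have ar0 : 0 < `|xn| + rho by rewrite ltr_pwDl.
rewrite ler_pdivlMr ?powR_gt0// mulrC ler_pdivrMr ?powR_gt0//.
rewrite -powRM ?normr_ge0//; apply: ge0_ler_powR => //; rewrite ?nnegrE.
- exact: ltW.
- by rewrite mulr_ge0.
- by move: hM; rewrite ler_pdivrMr// mulrDl mul1r lerD2l.
Qed.
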